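(* Let $\mathcal{L}\subseteq\mathbb{C}^n$ be a linear subspace invariant under complex conjugation, let $I\subseteq[n]$, and let $w\in(\mathbb{R}_{>0})^n$ have pairwise distinct coordinates. Then the following numbers are equal: (1) the degree of the affine variety $\mathrm{inv}_I(\mathcal{L})$; (2) the number of facets of the semi-broken circuit complex $\Delta_w(M(\mathcal{L}),I)$; (3) for generic $u\in\mathbb{R}^n$, the number of regions of $(\mathcal{L}^\perp+u)\setminus\bigcup_{i\in I}\{x_i=0\}$ whose recession cones intersect $\mathbb{R}^I=\{x\in\mathbb{R}^n: x_j=0\text{ for } j\notin I\}$ only in $\{0\}$.
   Context: $\mathrm{inv}_I:\mathbb{C}^n\dashrightarrow\mathbb{C}^n$ is given by $(\mathrm{inv}_I(x))_i=1/x_i$ for $i\in I$ and $x_i$ for $i\notin I$; $\mathrm{inv}_I(\mathcal{L})$ is the Zariski closure of the image of $\mathcal{L}$ under this map. $\mathcal{L}^\perp=\{v\in\mathbb{C}^n:\sum_iv_ix_i=0 \ \forall x\in\mathcal{L}\}$; since $\mathcal{L}$ is conjugation invariant, $\mathcal{L}^\perp$ is spanned by real vectors and $\mathcal{L}^\perp+u$ is considered here as a real affine subspace of $\mathbb{R}^n$; its regions are the connected components of the complement of the hyperplanes $\{x_i=0\}$, $i\in I$, in it, and the recession cone of a region $R$ is $\{v: x+tv\in R \ \forall x\in R, t\ge0\}$. The circuits of the matroid $M(\mathcal{L})$ are the inclusion-minimal supports of nonzero linear forms $\sum a_ix_i$ vanishing on $\mathcal{L}$. A vector $w$ with distinct coordinates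 orders $[n]$ by $i<j$ iff $w_i<w_j$. For a circuit $C$, $b_I(C)=C\setminus\min(C)$ if $C\subseteq I$ and $b_I(C)=(C\cap I)\cup\{\max(C\setminus I)\}$ otherwise; $\Delta_w(M,I)$ is the simplicial complex of all $\tau\subseteq[n]$ containing no set $b_I(C)$, $C$ a circuit. Facets are inclusion-maximal faces. *)

(* Defs.v *)
From HB Require Import structures.
From mathcomp Require Import all_boot all_order all_algebra.
From mathcomp Require Import complex.
From mathcomp Require Import -(notations) mpoly.
From mathcomp Require Import boolp classical_sets cardinality reals topology normedtype.

Set Implicit Arguments.
Unset Strict Implicit.
Unset Printing Implicit Defensive.

Import Order.TTheory GRing.Theory Num.Theory.
Import numFieldNormedType.Exports.
Local Open Scope ring_scope.

(* Points of K^n are row vectors; the variables x_1, ..., x_n are indexed by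
   'I_n.  The field C of complex numbers is R[i] with R : realType. *)

Definition peval (K : comNzRingType) (n : nat) (p : mpoly n K)
  (x : 'rV[K]_n) : K := meval (fun i => x ord0 i) p.

Definition supp (K : nmodType) (n : nat) (a : 'rV[K]_n) : {set 'I_n} :=
  [set i | a ord0 i != 0].

Section LinearSpace.
Variables (R : realType) (n : nat).
Implicit Types (L : {vspace 'rV[R[i]]_n}) (I : {set 'I_n}).

Definition conj_invariant L : Prop :=
  forall x, x \in L -> map_mx (@conjc R) x \in L.

Definition perp L : set 'rV[R[i]]_n :=
  fun v => forall x, x \in L -> \sum_i v ord0 i * x ord0 i = 0.

(* A vector a stands for the linear form \sum_i a_i x_i. *)
Definition circuits L : {set {set 'I_n}} :=
  [set C | minset (fun S => `[< exists a, [/\ perp L a, a != 0 & supp a = S] >])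
             C].

End LinearSpace.

Section SemiBrokenCircuits.
Variables (R : realType) (n : nat).
Implicit Types (w : 'rV[R]_n) (I C : {set 'I_n}) (M : {set {set 'I_n}}).

(* The set of w-minimal (w-maximal) elements of S: when the coordinates of w
   are pairwise distinct, it is {min(S)} ({max(S)}) for S nonempty, and it is
   empty for S empty. *)
Definition wmin w (S : {set 'I_n}) : {set 'I_n} :=
  [set i in S | [forall j in S, w ord0 i <= w ord0 j]].

Definition wmax w (S : {set 'I_n}) : {set 'I_n} :=
  [set i in S | [forall j in S, w ord0 j <= w ord0 i]].

Definition semi_broken w I C : {set 'I_n} :=
  if C \subset I then C :\: wmin w C else (C :&: I) :|: wmax w (C :\: I).

(* A matroid M is given by its set of circuits. *)
Definition semi_broken_complex w M I : {set {set 'I_n}} :=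
  [set tau : {set 'I_n} |
     [forall C in M, ~~ (semi_broken w I C \subset tau)]].

Definition facets (Delta : {set {set 'I_n}}) : {set {set 'I_n}} :=
  [set tau | maxset (fun s => s \in Delta) tau].

End SemiBrokenCircuits.

Local Open Scope classical_set_scope.

Section Degree.
Variables (K : fieldType) (n : nat).
Implicit Types (X : set 'rV[K]_n) (p : mpoly n K).

Definition vanishes_on X p : Prop := forall x, X x -> peval p x = 0.

Definition zariski_closure X : set 'rV[K]_n :=
  [set x | forall p, vanishes_on X p -> peval p x = 0].

(* The affine Hilbert function of X takes the value N at s, i.e.
   dim K[x]_{<= s} / I(X)_{<= s} = N: the classes of the b_i form a basis of
   this quotient.  (msize is the total degree plus one, and msize 0 = 0.) *)
Definition affine_hilbert_function X (s N : nat) : Prop :=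
  exists b : 'I_N -> mpoly n K,
  [/\ forall i, (msize (b i) <= s.+1)%N,
      forall c : 'I_N -> K, vanishes_on X (\sum_i c i *: b i) ->
        forall i, c i = 0
    & forall p, (msize p <= s.+1)%N ->
        exists c : 'I_N -> K, vanishes_on X (p - \sum_i c i *: b i)].

(* The affine Hilbert function of X is the Hilbert function of the projective
   closure of X. *)
Definition hilbert_polynomial X (P : {poly rat}) : Prop :=
  exists s0 : nat, forall s : nat, (s0 <= s)%N ->
    exists2 N : nat, affine_hilbert_function X s N & P.[s%:R] = N%:R.

(* The degree of X is d! times the leading coefficient of its Hilbert
   polynomial, where d, the degree of this polynomial, is dim X.  The empty
   variety has Hilbert polynomial 0, hence degree 0. *)
Definition has_degree X (delta : nat) : Prop :=
  exists2 P : {poly rat}, hilbert_polynomial X P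
    & ((size P).-1)`!%:R * lead_coef P = delta%:R.

End Degree.

Section InvertedSpace.
Variables (R : realType) (n : nat).
Implicit Types (L : {vspace 'rV[R[i]]_n}) (I : {set 'I_n}).

Definition inv_coord I (x : 'rV[R[i]]_n) : 'rV[R[i]]_n :=
  \row_i (if i \in I then (x ord0 i)^-1 else x ord0 i).

(* The image is taken over the domain of definition of the rational map (the
   inverse of 0 is 0 in MathComp). *)
Definition inv_space L I : set 'rV[R[i]]_n :=
  zariski_closure
    (inv_coord I @` [set x | x \in L /\ forall i, i \in I -> x ord0 i != 0]).

End InvertedSpace.

Section Regions.
Variables (R : realType) (n : nat).
Implicit Types (A : set 'rV[R]_n) (I : {set 'I_n}).

Definition real_points (A : set 'rV[R[i]]_n) : set 'rV[R]_n :=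
  [set v | A (map_mx (real_complex R) v)].

(* L^perp + u, as a real affine subspace of R^n *)
Definition affine_perp (L : {vspace 'rV[R[i]]_n}) (u : 'rV[R]_n) :
  set 'rV[R]_n := [set v + u | v in real_points (perp L)].

Definition arrangement_complement A I : set 'rV[R]_n :=
  [set x | A x /\ forall i, i \in I -> x ord0 i != 0].

Definition regions A I : set (set 'rV[R]_n) :=
  [set connected_component (arrangement_complement A I) x
     | x in arrangement_complement A I].

Definition recession_cone A : set 'rV[R]_n :=
  [set v | forall x (t : R), A x -> 0 <= t -> A (x + t *: v)].

Definition coord_subspace I : set 'rV[R]_n :=
  [set x | forall j, j \notin I -> x ord0 j = 0].

(* P holds outside the zero locus of some nonzero polynomial. *)
Definition generically (P : 'rV[R]_n -> Prop) : Prop :=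
  exists2 p : mpoly n R, p != 0 & forall u, peval p u != 0 -> P u.

End Regions.

(* Main.v *)
Require Import Defs.
From HB Require Import structures.
From mathcomp Require Import all_boot all_order all_algebra.
From mathcomp Require Import complex.
From mathcomp Require Import -(notations) mpoly.
From mathcomp Require Import boolp classical_sets cardinality reals topology normedtype.
From mathcomp Require Import ring.
From mathcomp Require Import fintype finset.

(* Let i be the element of I with the largest weight, I' = I \ {i}, and let L/i
   and L\i be the contraction and the deletion of i. If i is not a loop, the
   faces of Delta(L, I) that contain i are those of Delta(L/i, I') with i added,
   and the other faces are those of Delta(L\i, I'). Hence the complex is pure of
   dimension dim L - 1 and its number of facets satisfies a deletion-contraction
   recursion.

   Degree. Modulo the circuit relations every monomial reduces to monomials
   supported on faces, and the reduction decreases the w-weight without raising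
   the degree. These standard monomials are linearly independent on inv_I(L):
   write a relation as the sum of f_k x_i^k; letting the i-th coordinate of the
   point of L tend to 0 shows that the top coefficient vanishes on inv_I'(L/i),
   so it is 0 by induction, and once only f_0 is left it vanishes on
   inv_I'(L\i). So the affine Hilbert function of inv_I(L) at s is the sum over
   the faces tau of binomial(s, #tau).

   Regions. They correspond to sign vectors on I. Erasing the hyperplane x_i = 0
   turns the cells of (L, I) into those of (L/i, I'), and intersecting with it
   gives those of (L\i, I'). The number of cells whose cone meets R^I only in 0
   satisfies the same recursion; genericity of u is used only for u_i != 0 when
   i is a coloop. *)

Import Order.TTheory GRing.Theory Num.Theory.
Import numFieldNormedType.Exports.
Local Open Scope ring_scope.

Set Implicit Arguments.
Unset Strict Implicit.

(** * Linear forms, deletion and contraction *)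

Section Dot.
Variables (K : fieldType) (n : nat).
Implicit Types (a x y : 'rV[K]_n) (B : {set 'I_n}).

Definition dot a x : K := \sum_i a ord0 i * x ord0 i.

Definition mask B x : 'rV[K]_n := \row_j (if j \in B then x ord0 j else 0).

Definition unit_row (i : 'I_n) : 'rV[K]_n := delta_mx ord0 i.

Lemma maskE B x j : mask B x ord0 j = if j \in B then x ord0 j else 0.
Proof. by rewrite mxE. Qed.

Lemma unit_rowE i j : unit_row i ord0 j = (j == i)%:R.
Proof. by rewrite mxE eqxx. Qed.

Lemma row0P x y : (forall j, x ord0 j = y ord0 j) <-> x = y.
Proof. by split=> [e|->//]; apply/rowP. Qed.

Fact mask_is_linear B : linear (mask B).
Proof.
move=> c x y; apply/row0P => j; rewrite !mxE.
by case: ifP => // _; rewrite mulr0 addr0.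
Qed.

HB.instance Definition _ B :=
  GRing.isLinear.Build K 'rV[K]_n 'rV[K]_n _ (mask B) (mask_is_linear B).

Lemma dotC a x : dot a x = dot x a.
Proof. by apply: eq_bigr => i _; rewrite mulrC. Qed.

Lemma dotDl a b x : dot (a + b) x = dot a x + dot b x.
Proof. by rewrite -big_split; apply: eq_bigr => i _; rewrite mxE mulrDl. Qed.

Lemma dotZl c a x : dot (c *: a) x = c * dot a x.
Proof. by rewrite /dot mulr_sumr; apply: eq_bigr => i _; rewrite mxE mulrA. Qed.

Lemma dotBl a b x : dot (a - b) x = dot a x - dot b x.
Proof. by rewrite -scaleN1r dotDl dotZl mulN1r. Qed.

Lemma dotBr a x y : dot a (x - y) = dot a x - dot a y.
Proof. by rewrite dotC dotBl !(dotC a). Qed.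

Lemma dotZr c a x : dot a (c *: x) = c * dot a x.
Proof. by rewrite dotC dotZl dotC. Qed.

Lemma dot_unit i x : dot (unit_row i) x = x ord0 i.
Proof.
rewrite /dot (bigD1 i) //= unit_rowE eqxx mul1r big1 ?addr0 // => j ji.
by rewrite unit_rowE (negPf ji) mul0r.
Qed.

Lemma dot_mask B a x : dot (mask B a) x = dot a (mask B x).
Proof.
apply: eq_bigr => j _; rewrite !maskE; case: ifP => // _.
by rewrite mul0r mulr0.
Qed.

Lemma mask1E i x : mask [set i] x = x ord0 i *: unit_row i.
Proof.
apply/row0P => j; rewrite maskE mxE unit_rowE inE; case: eqP => [->|_].
  by rewrite mulr1.
by rewrite mulr0.
Qed.

Lemma maskC1E i x : mask [set~ i] x = x - x ord0 i *: unit_row i.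
Proof.
apply/row0P => j; rewrite maskE !mxE !inE eqxx /=; case: eqP => [->|_].
  by rewrite mulr1 subrr.
by rewrite mulr0 subr0.
Qed.

Lemma supp_mask B x : supp (mask B x) = supp x :&: B.
Proof.
by apply/setP => j; rewrite !inE maskE; case: ifP; rewrite ?eqxx ?andbT ?andbF.
Qed.

Lemma supp_unit i : supp (unit_row i) = [set i].
Proof.
apply/setP => j; rewrite !inE unit_rowE.
by case: (j == i); rewrite ?oner_eq0 ?eqxx.
Qed.

Lemma unit_row_neq0 i : unit_row i != 0.
Proof. by apply/eqP => /row0P/(_ i)/eqP; rewrite unit_rowE mxE eqxx oner_eq0. Qed.

Lemma supp_eq0 x : (supp x == set0) = (x == 0).
Proof.
apply/eqP/eqP => [/setP e|->].
  apply/row0P => j; have := e j.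
  by rewrite !inE mxE => /negbT; rewrite negbK => /eqP.
by apply/setP => j; rewrite !inE mxE eqxx.
Qed.

Lemma mask_eq0 i x : mask [set~ i] x = 0 -> x = x ord0 i *: unit_row i.
Proof. by rewrite maskC1E => /eqP; rewrite subr_eq0 => /eqP. Qed.

End Dot.

Section Perp.
Variables (R : realType) (n : nat).
Local Notation K := R[i].
Implicit Types (L : {vspace 'rV[K]_n}) (a b x : 'rV[K]_n) (i : 'I_n).

Lemma perpZ L c a : perp L a -> perp L (c *: a).
Proof. by move=> La x Lx; rewrite -/(dot _ _) dotZl [dot a x]La ?mulr0. Qed.

Lemma perpD L a b : perp L a -> perp L b -> perp L (a + b).
Proof.
by move=> La Lb x Lx; rewrite -/(dot _ _) dotDl [dot a x]La ?[dot b x]Lb ?addr0.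
Qed.

Lemma perpB L a b : perp L a -> perp L b -> perp L (a - b).
Proof. by move=> La /(perpZ (-1)); rewrite scaleN1r => /(perpD La). Qed.

(** The map that sends [y] to [y - projv L y] is zero on [L] and nonzero at [x]. Any coordinate of
    it that is nonzero at [x] is the required form. *)
Lemma perp_sep L x : x \notin L -> exists2 a, perp L a & dot a x != 0.
Proof.
move=> Lx; pose g y : 'rV[K]_n := y - projv L y.
have gL y : y \in L -> g y = 0 by move=> Ly; rewrite /g projv_id // subrr.
have: g x != 0.
  by apply: contra Lx; rewrite subr_eq0 => /eqP ->; exact: memv_proj.
rewrite -supp_eq0 => /set0Pn [j]; rewrite inE => gx.
pose a : 'rV[K]_n := \row_k g (unit_row _ k) ord0 j.
have ga y : dot a y = g y ord0 j.
  have -> : g y = \sum_k y ord0 k *: g (unit_row _ k).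
    rewrite {1}(row_sum_delta y) /g linear_sum -sumrB.
    by apply: eq_bigr => k _; rewrite linearZ scalerBr.
  rewrite summxE; apply: eq_bigr => k _.
  by rewrite [a _ _]mxE [in RHS]mxE mulrC.
exists a; last by rewrite ga.
by move=> y Ly; rewrite -/(dot a y) ga gL // mxE.
Qed.

(* Both minors stay in the ambient space, where i becomes a loop. *)
Definition deletion L i := (linfun (mask [set~ i]) @: L)%VS.

Definition contraction L i := (L :&: lker (linfun (mask [set i])))%VS.

Lemma mem_deletion L i x :
  x \in deletion L i <-> exists2 y, y \in L & x = mask [set~ i] y.
Proof.
split=> [/memv_imgP[y Ly ->]|[y Ly ->]]; first by exists y; rewrite ?lfunE.
by apply/memv_imgP; exists y; rewrite ?lfunE.
Qed.

Lemma mem_contraction L i x :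
  (x \in contraction L i) = (x \in L) && (x ord0 i == 0).
Proof.
rewrite memv_cap memv_ker lfunE /= mask1E scaler_eq0.
by rewrite (negPf (unit_row_neq0 _ _)) orbF.
Qed.

Definition is_loop L i := perp L (unit_row _ i).

Definition is_coloop L i := unit_row _ i \in L.

Lemma nonloop_witness L i : ~ is_loop L i -> exists2 e, e \in L & e ord0 i = 1.
Proof.
move=> /existsNP[x /not_implyP[Lx]]; rewrite -/(dot _ _) dot_unit => /eqP xi.
by exists ((x ord0 i)^-1 *: x); rewrite ?memvZ // mxE mulVf.
Qed.

Lemma perp_deletion L i a :
  perp (deletion L i) a <-> perp L (mask [set~ i] a).
Proof.
split=> aL x; rewrite -/(dot _ _).
  by move=> Lx; rewrite dot_mask; apply: aL; apply/mem_deletion; exists x.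
by move=> /mem_deletion[y Ly ->]; rewrite -dot_mask; exact: aL.
Qed.

Lemma perp_contraction L i a : ~ is_loop L i ->
  perp (contraction L i) a <-> exists c, perp L (a - c *: unit_row _ i).
Proof.
move=> /nonloop_witness [e Le ei]; split=> [aL|[c ac] x].
  (* With this constant the form vanishes on [e] as well as on L/i, and these together span [L]. *)
  exists (dot a e) => x Lx; rewrite -/(dot _ _) dotBl dotZl dot_unit.
  have /aL : x - x ord0 i *: e \in contraction L i.
    by rewrite mem_contraction rpredB ?memvZ //= !mxE ei mulr1 subrr.
  by rewrite -/(dot _ _) dotBr dotZr mulrC.
rewrite mem_contraction => /andP[Lx /eqP xi].
have := ac x Lx; rewrite -!/(dot _ _) dotBl dotZl dot_unit xi mulr0 subr0.
by [].
Qed.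

Lemma noncoloop_witness L i :
  ~~ is_coloop L i -> exists2 a, perp L a & a ord0 i != 0.
Proof. by move=> /perp_sep [a aL]; rewrite dotC dot_unit; exists a. Qed.

Lemma perp_coloop L i a : is_coloop L i -> perp L a -> a ord0 i = 0.
Proof. by move=> Li /(_ _ Li); rewrite -/(dot _ _) dotC dot_unit. Qed.

Lemma is_loop_deletion L i : is_loop (deletion L i) i.
Proof.
apply/perp_deletion => x _; apply: big1 => j _.
by rewrite maskE !inE unit_rowE; case: eqP; rewrite mul0r.
Qed.

Lemma is_loop_contraction L i : is_loop (contraction L i) i.
Proof.
by move=> x; rewrite -/(dot _ _) dot_unit mem_contraction => /andP[_ /eqP].
Qed.

(** Rank-nullity for the i-th coordinate on [L]: its kernel is L/i and its image is a line because
    [i] is not a loop. *)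
Lemma dim_contraction L i :
  ~ is_loop L i -> \dim L = (\dim (contraction L i)).+1.
Proof.
move=> /nonloop_witness [e Le ei].
suff im : (linfun (mask [set i]) @: L = <[unit_row _ i]>)%VS.
  have := limg_ker_dim (linfun (mask [set i])) L.
  by rewrite im dim_vline unit_row_neq0 addn1 => <-.
apply/vspaceP => x; apply/memv_imgP/vlineP => [[y Ly ->]|[c ->]].
  by exists (y ord0 i); rewrite lfunE /= mask1E.
by exists (c *: e); rewrite ?memvZ // lfunE /= mask1E mxE ei mulr1.
Qed.

(** Erasing the i-th coordinate can only kill multiples of [unit_row _ i], and [L] contains none but
    0. *)
Lemma dim_deletion L i : ~~ is_coloop L i -> \dim (deletion L i) = \dim L.
Proof.
move=> Li.
suff ker : (L :&: lker (linfun (mask [set~ i])) = 0)%VS.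
  by have := limg_ker_dim (linfun (mask [set~ i])) L; rewrite ker dimv0.
apply/eqP; rewrite -subv0; apply/subvP => x.
rewrite memv_cap memv_ker lfunE /= memv0 => /andP[Lx /eqP /mask_eq0 ex].
apply: contraNT Li => x0; have xi : x ord0 i != 0.
  by apply: contra x0 => /eqP xi; rewrite ex xi scale0r.
by rewrite /is_coloop -[unit_row _ i](scalerK xi) -ex memvZ.
Qed.

(** When [unit_row _ i] lies in [L], erasing a coordinate does not leave [L], so projecting and
    slicing give the same space. *)
Lemma deletion_coloop L i : is_coloop L i -> deletion L i = contraction L i.
Proof.
move=> Li; apply/vspaceP => x; apply/idP/idP.
  move=> /mem_deletion [y Ly ->]; rewrite mem_contraction maskE !inE eqxx eqxx.
  by rewrite maskC1E rpredB ?memvZ.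
rewrite mem_contraction => /andP[Lx /eqP xi]; apply/mem_deletion; exists x => //.
by rewrite maskC1E xi scale0r subr0.
Qed.

End Perp.

(** * Semi-broken circuit complexes *)

Section SemiBroken.
Variables (R : realType) (n : nat) (w : 'rV[R]_n).
Local Notation K := R[i].
Implicit Types (L : {vspace 'rV[K]_n}) (a b x : 'rV[K]_n) (i j k : 'I_n).
Implicit Types (I S T C tau : {set 'I_n}).

Local Notation Delta L I := (semi_broken_complex w (circuits L) I).

Lemma wmaxP T j :
  reflect (j \in T /\ forall k, k \in T -> w ord0 k <= w ord0 j)
          (j \in wmax w T).
Proof.
rewrite inE; apply: (iffP andP) => [[Tj /forall_inP]//|[Tj h]].
by split=> //; apply/forall_inP.
Qed.

Lemma wminPn T j : j \in T -> j \notin wmin w T ->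
  exists2 k, k \in T & w ord0 k < w ord0 j.
Proof.
rewrite inE => -> /= /forall_inPn[k Tk]; rewrite -ltNge => jk.
by exists k.
Qed.

Lemma notin_wmin T j k : k \in T -> w ord0 k < w ord0 j -> j \notin wmin w T.
Proof.
move=> Tk kj; rewrite inE negb_and; apply/orP; right.
by apply/forall_inPn; exists k => //; rewrite -ltNge.
Qed.

Lemma wmax_neq0 T j : j \in T -> exists k, k \in wmax w T.
Proof.
move=> Tj; case: (arg_maxP (fun k => w ord0 k) Tj) => k Tk kmax.
by exists k; apply/wmaxP.
Qed.

Lemma semi_broken_sub I S : semi_broken w I S \subset S.
Proof.
rewrite /semi_broken; case: ifP => _; first exact: subsetDl.
rewrite subUset subsetIl /=; apply/subsetP => j /wmaxP[].
by rewrite inE => /andP[].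
Qed.

Lemma semi_brokenD1 I S i :
  i \notin S -> semi_broken w (I :\ i) S = semi_broken w I S.
Proof.
move=> iS; have SI T : i \notin S -> (S :&: (I :\ i) = S :&: I) /\
    (S :\: (I :\ i) = S :\: I).
  move=> _; split; apply/setP => j; rewrite !inE; case: eqP => [->|//].
    by rewrite (negPf iS).
  by rewrite (negPf iS) !andbF.
rewrite /semi_broken subsetD1 iS andbT.
by have [-> ->] := SI set0 iS.
Qed.

(** If [S] lies in [I], then [i] is its heaviest element but not its only one, so the minimum to be
    dropped is another element and is the same for [S :\ i]. Otherwise the maximum is taken outside
    [I], where [i] does not matter. *)
Lemma semi_broken_max I S i : injective (w ord0) ->
    i \in I -> (forall k, k \in I -> w ord0 k <= w ord0 i) ->
    i \in S -> S != [set i] ->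
  semi_broken w I S = i |: semi_broken w (I :\ i) (S :\ i).
Proof.
move=> w_inj Ii imax Si Sni; rewrite /semi_broken.
have SI : (S :\ i \subset I :\ i) = (S \subset I).
  apply/subsetP/subsetP => h j.
    move=> Sj; case: (eqVneq j i) => [->//|ji].
    by have := h j; rewrite !inE ji /= => ->.
  by rewrite !inE => /andP[-> /h].
have [j Sj ji] : exists2 j, j \in S & j != i.
  apply/exists_inP; rewrite -negb_forall_in; apply: contra Sni => /forall_inP h.
  apply/eqP/setP => j; rewrite inE; apply/idP/eqP => [/h/eqP//|->//].
rewrite SI; case: ifPn => SubI.
  have ltji : w ord0 j < w ord0 i.
    rewrite lt_neqAle imax ?(subsetP SubI) // andbT.
    by apply: contra ji => /eqP/w_inj ->.
  apply/setP => l; rewrite in_setU1 !in_setD; case: (eqVneq l i) => [->|li] /=.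
    by rewrite Si andbT (notin_wmin Sj).
  rewrite !inE li; case Sl: (l \in S); rewrite ?andbT ?andbF //=; congr (~~ _).
  apply/forall_inP/forall_inP => h k; first by rewrite !inE => /andP[_ /h].
  case: (eqVneq k i) => [-> _|ki Sk]; last by apply: h; rewrite !inE ki.
  by rewrite imax ?(subsetP SubI).
have -> : (S :\ i) :\: (I :\ i) = S :\: I.
  apply/setP => l; rewrite !inE; case: (eqVneq l i) => [->|//] /=.
  by rewrite Ii.
apply/setP => l; rewrite in_setU1 !in_setU !in_setI !in_setD1.
by case: (eqVneq l i) => [->|//]; rewrite Si Ii.
Qed.

(** Here [i] counts as an element outside [I :\ i]. It is left out only if some heavier [j] is the
    maximum there, and this maximum survives the removal of [i] from [S]. *)
Lemma semi_broken_out I S i :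
    i \in S -> i \notin semi_broken w (I :\ i) S ->
  S != [set i] /\ semi_broken w (I :\ i) (S :\ i) \subset semi_broken w (I :\ i) S.
Proof.
move=> Si; have iSI : i \in S :\: (I :\ i) by rewrite !inE eqxx.
have nSI (T : {set 'I_n}) : (i \in T) -> (T \subset I :\ i) = false.
  by move=> Ti; apply/negP => /subsetP/(_ i Ti); rewrite !inE eqxx.
rewrite /semi_broken nSI // inE negb_or => /andP[_ imax].
have [j jmax] := wmax_neq0 iSI; have /wmaxP[jSI jle] := jmax.
have ji : j != i by apply: contra imax => /eqP e; rewrite -{1}e.
have Sij : j \in S :\ i by move: jSI; rewrite !inE ji => /andP[].
split; first by apply: contraTneq Sij => ->; rewrite !inE andNb.
rewrite ifN; last first.
  apply/negP => /subsetP/(_ j Sij); move: jSI; rewrite inE.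
  by case/andP => /negPf ->.
rewrite subUset; apply/andP; split; apply/subsetP => l.
  by rewrite !inE => /andP[/andP[_ ->] ->].
move=> /wmaxP[/setDP[/setD1P[li Sl] l1] lmax].
rewrite in_setU; apply/orP; right; apply/wmaxP; split=> [|k /jle kj].
  by rewrite in_setD l1 Sl.
apply: (le_trans kj); apply: lmax; rewrite in_setD Sij andbT.
by case/setDP: jSI.
Qed.

(** Take a support minimal among those containing [j]. A smaller support without [j] could be used
    to cancel one of its own elements while keeping the coefficient at [j], against this
    minimality. *)
Lemma circuit_through L a j : perp L a -> j \in supp a ->
  exists C, [/\ C \in circuits L, j \in C & C \subset supp a].
Proof.
move=> aL aj.
pose P S := `[< exists b, perp L b /\ supp b = S >] && (j \in S).
have Pa : P (supp a) by rewrite /P aj andbT; apply/asboolP; exists a.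
have [C /minsetP[/andP[/asboolP[b [bL bC]] Cj] Cmin] Csub] := minset_exists Pa.
exists C; split=> //; rewrite inE; apply/minsetP; split.
  by apply/asboolP; exists b; split=> //; rewrite -supp_eq0 bC; apply/set0Pn; exists j.
move=> S /asboolP[c [cL c0 <-]] cC.
case cj: (j \in supp c).
  by apply: Cmin => //; rewrite /P cj andbT; apply/asboolP; exists c.
have /set0Pn [k ck] : supp c != set0 by rewrite supp_eq0.
pose d := b - (b ord0 k / c ord0 k) *: c.
have dC : supp d \subset C.
  apply/subsetP => l; apply: contraLR => lC.
  have := contra (subsetP cC l) lC; move: lC; rewrite -bC !inE !negbK.
  by move=> /eqP bl /eqP cl; rewrite !mxE bl cl mulr0 subr0.
have dj : j \in supp d.
  move: Cj cj; rewrite -bC !inE !mxE => bj /negbFE/eqP ->.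
  by rewrite mulr0 subr0.
have eC : supp d = C.
  apply: Cmin => //; rewrite /P dj andbT; apply/asboolP; exists d; split=> //.
  exact/perpB/perpZ.
have := subsetP cC k ck; rewrite -eC !inE !mxE.
by move: ck; rewrite inE => ck; rewrite divfK // subrr eqxx.
Qed.

(* Supports of arbitrary forms may replace circuits: a support S contains a
   circuit through the maximum of S \ I, or any circuit when S is in I. *)
Lemma in_complexP L I tau :
  tau \in Delta L I <->
  forall a, perp L a -> a != 0 -> ~~ (semi_broken w I (supp a) \subset tau).
Proof.
rewrite inE; split=> [/forall_inP h a aL a0|h]; last first.
  apply/forall_inP => C; rewrite inE => /minsetP[/asboolP[a [aL a0 <-]] _].
  exact: h.
have /set0Pn [j0 Sj0] : supp a != set0 by rewrite supp_eq0.
apply/negP => sub.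
suff [C CL bC] : exists2 C, C \in circuits L &
    semi_broken w I C \subset semi_broken w I (supp a).
  by have := h C CL; rewrite (subset_trans bC sub).
rewrite {2}/semi_broken; case: ifPn => SI.
  have [C [CL Cj CS]] := circuit_through aL Sj0; exists C => //.
  rewrite /semi_broken (subset_trans CS SI).
  apply/subsetP => l; rewrite !in_setD => /andP[lmin Cl].
  rewrite (subsetP CS) // andbT.
  have [k Ck kl] := wminPn Cl lmin.
  by apply: notin_wmin kl; exact: (subsetP CS).
have [k0 Sk0] : exists j, j \in supp a :\: I.
  by have /subsetPn [j Sj jI] := SI; exists j; rewrite in_setD Sj jI.
have [j /wmaxP[jSI jmax]] := wmax_neq0 Sk0.
have /setDP[Sj jI] := jSI.
have [C [CL Cj CS]] := circuit_through aL Sj; exists C => //.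
rewrite /semi_broken ifN; last first.
  by apply/subsetPn; exists j.
apply: setUSS; first exact: setSI.
apply/subsetP => k /wmaxP[/setDP[Ck kI] kmax]; apply/wmaxP; split.
  by rewrite in_setD kI (subsetP CS).
move=> l /jmax lj; apply: (le_trans lj); apply: kmax.
by rewrite in_setD jI Cj.
Qed.

Lemma notin_complexP L I tau :
  tau \notin Delta L I <->
  exists a, [/\ perp L a, a != 0 & semi_broken w I (supp a) \subset tau].
Proof.
split=> [|[a [aL a0 h]]]; last first.
  by apply/negP => /in_complexP/(_ a aL a0); rewrite h.
move=> /negP h; apply: contrapT => nex; apply: h; apply/in_complexP => a aL a0.
by apply/negP => sub; apply: nex; exists a.
Qed.

(** The circuit {i} breaks to the empty set, which every [tau] contains; so not even the empty set
    is a face. *)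
Lemma complex_loop L I i : i \in I -> is_loop L i -> Delta L I = set0.
Proof.
move=> Ii iL; apply/setP => tau; rewrite [RHS]inE; apply/negbTE/notin_complexP.
exists (unit_row _ i); split=> //; first exact: unit_row_neq0.
rewrite supp_unit /semi_broken sub1set Ii.
apply/subsetP => j; rewrite !inE => /andP[+ /eqP ji].
rewrite ji negb_and eqxx /= => /forall_inPn[k]; rewrite inE => /eqP ->.
by rewrite lexx.
Qed.

(** In both minors [i] remains as a loop outside [I :\ i]; this is what keeps it out of their
    faces. *)
Lemma complex_loop_notin L I i tau :
  i \notin I -> is_loop L i -> tau \in Delta L I -> i \notin tau.
Proof.
move=> Ii iL /in_complexP/(_ _ iL (unit_row_neq0 _ _)); apply: contra => itau.
apply: subset_trans (semi_broken_sub _ _) _.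
by rewrite supp_unit sub1set.
Qed.

Lemma supp_maskC1 i a : supp (mask [set~ i] a) = supp a :\ i.
Proof. by rewrite supp_mask; apply/setP => j; rewrite !inE andbC. Qed.

Lemma perp_single_loop L i a :
  perp L a -> a != 0 -> mask [set~ i] a = 0 -> is_loop L i.
Proof.
move=> aL a0 /mask_eq0 ea; have ai : a ord0 i != 0.
  by apply: contra a0 => /eqP ai; rewrite ea ai scale0r.
by rewrite /is_loop -[unit_row _ i](scalerK ai) -ea; apply: perpZ.
Qed.

Lemma mask_supp_neq i a : a != 0 -> supp a != [set i] -> mask [set~ i] a != 0.
Proof.
move=> a0; apply: contra => /eqP ea; rewrite (mask_eq0 ea).
apply/eqP/setP => j; rewrite !inE mxE unit_rowE.
have ai : a ord0 i != 0.
  by apply: contra a0 => /eqP ai; rewrite (mask_eq0 ea) ai scale0r.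
by case: (j == i); rewrite ?mulr1 ?mulr0 ?eqxx.
Qed.

Lemma mask_id i a : i \notin supp a -> mask [set~ i] a = a.
Proof.
by rewrite inE negbK => /eqP ai; rewrite maskC1E ai scale0r subr0.
Qed.

(** * Faces with and without the heaviest element of [I] *)

Section Link.
Variables (I : {set 'I_n}) (i : 'I_n).
Hypotheses (w_inj : injective (w ord0)) (Ii : i \in I).
Hypothesis imax : forall k, k \in I -> w ord0 k <= w ord0 i.

Let masked a tau : a != 0 -> semi_broken w (I :\ i) (supp a) \subset tau ->
  i \notin tau -> mask [set~ i] a != 0 /\
  semi_broken w (I :\ i) (supp (mask [set~ i] a)) \subset tau.
Proof.
move=> a0 sub itau; case: (boolP (i \in supp a)) => ia; last by rewrite mask_id.
have [ni sub'] := semi_broken_out ia (contra (subsetP sub i) itau).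
rewrite supp_maskC1 (subset_trans sub' sub); split=> //.
exact: mask_supp_neq.
Qed.

(** By [semi_broken_max], a form with [i] in its support has [i] in its broken set, so a form that
    makes [tau] a nonface misses [i] and is a form on L\i. Conversely, by [semi_broken_out] the i-th
    term of a form may be erased while the broken set stays inside [tau]. *)
Lemma complex_deletion L tau : ~ is_loop L i -> i \notin tau ->
  (tau \in Delta L I) = (tau \in Delta (deletion L i) (I :\ i)).
Proof.
move=> iL itau; apply: negb_inj; apply/idP/idP => /notin_complexP[a [aL a0 sub]].
  have ia : i \notin supp a.
    apply/negP => ia; have [e|ne] := eqVneq (supp a) [set i].
      apply: iL; apply: perp_single_loop aL a0 _; apply/eqP.
      by rewrite -supp_eq0 supp_maskC1 e setDv.
    move: sub; rewrite (semi_broken_max w_inj Ii imax ia ne) subUset.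
    by rewrite sub1set (negPf itau).
  apply/notin_complexP; exists a; rewrite semi_brokenD1 //; split=> //.
  by apply/perp_deletion; rewrite mask_id.
have [b0 bsub] := masked a0 sub itau.
apply/notin_complexP; exists (mask [set~ i] a); split=> //.
  exact/perp_deletion.
by rewrite -(@semi_brokenD1 _ _ i) // supp_maskC1 !inE eqxx.
Qed.

(** Forms on L/i are forms on [L] whose i-th coefficient is arbitrary. Erasing or restoring this
    coefficient adds or removes at most [i] in the broken set, and [i |: tau] has room for it. *)
Lemma complex_contraction L tau : ~ is_loop L i -> i \notin tau ->
  (i |: tau \in Delta L I) = (tau \in Delta (contraction L i) (I :\ i)).
Proof.
move=> iL itau; apply: negb_inj; apply/idP/idP => /notin_complexP[a [aL a0 sub]].
  pose b := mask [set~ i] a.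
  have b0 : b != 0.
    by apply/eqP => b0; apply: iL; apply: perp_single_loop aL a0 b0.
  apply/notin_complexP; exists b; split=> //.
    apply/perp_contraction => //; exists (- a ord0 i).
    by rewrite scaleNr opprK /b maskC1E subrK.
  have isb : i \notin supp b by rewrite supp_maskC1 !inE eqxx.
  have nib : i \notin semi_broken w (I :\ i) (supp b).
    by apply: contra isb; apply/subsetP/semi_broken_sub.
  suff : semi_broken w (I :\ i) (supp b) \subset i |: tau.
    move=> /subsetP h; apply/subsetP => k kb.
    have := h k kb; rewrite in_setU1 => /orP[/eqP ki|//].
    by case/negP: nib; rewrite -{1}ki.
  apply: subset_trans sub; rewrite {}/b in b0 isb nib *.
  case: (boolP (i \in supp a)) => ia; last first.
    by rewrite mask_id // semi_brokenD1.
  rewrite supp_maskC1 (semi_broken_max w_inj Ii imax ia) ?subsetUr //.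
  by apply: contra b0 => /eqP e; rewrite -supp_eq0 supp_maskC1 e setDv.
have [b0 bsub] := masked a0 sub itau.
have /(perp_contraction _ iL)[c acL] := aL.
pose a' := a - c *: unit_row _ i.
have ea : mask [set~ i] a' = mask [set~ i] a.
  apply/row0P => j; rewrite !maskE !inE; case: eqP => //= /eqP ji.
  by rewrite !mxE eqxx (negPf ji) mulr0 subr0.
rewrite -ea supp_maskC1 in b0 bsub.
apply/notin_complexP; exists a'; split=> //.
  by apply: contra b0 => /eqP ->; rewrite linear0.
case: (boolP (i \in supp a')) => ia; last first.
  rewrite -(semi_brokenD1 _ ia); apply: subset_trans (subsetUr _ _).
  by move: bsub; rewrite -supp_maskC1 mask_id.
rewrite (semi_broken_max w_inj Ii imax ia); first exact: setUS.
apply: contra b0 => /eqP e; rewrite -supp_eq0 supp_maskC1 e setDv //.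
Qed.

End Link.

End SemiBroken.

Section Splitting.
Variables (T : finType) (i : T).
Implicit Types (A : {set T}) (P Q : pred {set T}).

Lemma card_split P :
  #|[set A : {set T} | P A]| =
  (#|[set A : {set T} | (i \notin A) && P (i |: A)]| +
   #|[set A : {set T} | (i \notin A) && P A]|)%N.
Proof.
rewrite -(cardsID [set A : {set T} | i \in A]); congr (_ + _)%N; last first.
  by apply: eq_card => A; rewrite !inE.
rewrite -[RHS](card_in_imset (f := fun A => i |: A)); last first.
  move=> A B; rewrite !inE => /andP[iA _] /andP[iB _] e.
  by rewrite -(setU1K iA) e setU1K.
apply: eq_card => A; apply/idP/imsetP => [|[B]]; rewrite !inE.
  move=> /andP[PA iA]; exists (A :\ i); last by rewrite setD1K.
  by rewrite !inE eqxx setD1K.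
by move=> /andP[iB PB] ->; rewrite PB !inE eqxx.
Qed.

End Splitting.

(** * Purity of the complex and the recursion for its facets *)

Section Purity.
Variables (R : realType) (n : nat) (w : 'rV[R]_n).
Hypothesis w_inj : injective (w ord0).
Local Notation K := R[i].
Implicit Types (L : {vspace 'rV[K]_n}) (a b x z : 'rV[K]_n) (i j k : 'I_n).
Implicit Types (I S T C tau : {set 'I_n}).

Local Notation Delta L I := (semi_broken_complex w (circuits L) I).

(* For I empty, the complex is the simplex on this basis of the matroid. *)
Definition nonleading L : {set 'I_n} :=
  [set j | `[< forall a, perp L a -> a != 0 -> j \notin wmax w (supp a) >]].

Lemma in_nonleading L j :
  j \in nonleading L <->
  forall a, perp L a -> a != 0 -> j \notin wmax w (supp a).
Proof. by rewrite inE; split=> [/asboolP|h] //; apply/asboolP. Qed.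

(** With [I] empty, a support breaks to its single heaviest element. *)
Lemma complex_set0E L tau : (tau \in Delta L set0) = (tau \subset nonleading L).
Proof.
have sb S : S != set0 -> semi_broken w set0 S = wmax w S.
  by move=> S0; rewrite /semi_broken subset0 (negPf S0) setI0 set0U setD0.
apply/idP/idP => [/in_complexP h|/subsetP h].
  apply/subsetP => j jt.
  apply/in_nonleading => a aL a0; apply: contra (h a aL a0) => ja.
  rewrite sb ?supp_eq0 //; apply/subsetP => k /wmaxP[ak kmax].
  move/wmaxP: ja => [aj jmax]; suff -> : k = j by [].
  by apply: w_inj; apply: le_anti; rewrite kmax // jmax.
apply/in_complexP => a aL a0; rewrite sb ?supp_eq0 //; apply/negP => /subsetP sub.
have /set0Pn [j0 Sj0] : supp a != set0 by rewrite supp_eq0.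
have [j jmax] := wmax_neq0 w Sj0.
by have /in_nonleading/(_ a aL a0) := h j (sub j jmax); rewrite jmax.
Qed.

(** Otherwise a nonzero form supported in [nonleading L] would vanish on [L], and the heaviest
    element of its support would be leading. *)
Lemma nonleading_onto L z :
  exists2 x, x \in L & forall j, j \in nonleading L -> x ord0 j = z ord0 j.
Proof.
pose m := linfun (@mask K n (nonleading L)).
suff /memv_imgP[x Lx] : mask (nonleading L) z \in (m @: L)%VS.
  rewrite lfunE => /row0P e; exists x => // j Bj.
  by have := e j; rewrite !maskE Bj.
apply: contraT => /perp_sep[a aL az]; pose b := mask (nonleading L) a.
have b0 : b != 0.
  apply: contra az; rewrite -dot_mask -/b => /eqP ->.
  by apply/eqP; apply: big1 => j _; rewrite mxE mul0r.
have bL : perp L b.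
  move=> x Lx; rewrite -/(dot b x) dot_mask; apply: aL.
  by apply/memv_imgP; exists x; rewrite ?lfunE.
have /set0Pn [j0 Sj0] : supp b != set0 by rewrite supp_eq0.
have [j jmax] := wmax_neq0 w Sj0; have /wmaxP[bj _] := jmax.
move: bj; rewrite supp_mask in_setI => /andP[_ /in_nonleading/(_ b bL b0)].
by rewrite jmax.
Qed.

(** The lightest [j] with [x ord0 j] nonzero is the heaviest element of the support of some form on
    [L]. All other terms of that form are lighter and vanish at [x], so the form cannot vanish
    there. *)
Lemma nonleading_inj L x :
  x \in L -> (forall j, j \in nonleading L -> x ord0 j = 0) -> x = 0.
Proof.
move=> Lx xB; apply/eqP; apply: contraT; rewrite -supp_eq0 => /set0Pn[j0 xj0].
case: (arg_minP (fun k => w ord0 k) xj0) => j jx jmin.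
have xj : x ord0 j != 0 by have : j \in supp x := jx; rewrite inE.
have /in_nonleading : ~ j \in nonleading L by move/xB => e; rewrite e eqxx in xj.
move=> /existsNP[a /not_implyP[aL /not_implyP[a0 /negP]]].
rewrite negbK => /wmaxP[aj jmax]; have := aL x Lx.
rewrite (bigD1 j) //= big1 ?addr0 => [/eqP|k kj].
  by move: aj; rewrite inE mulf_eq0 (negPf xj) => /negPf ->.
apply/eqP; rewrite mulf_eq0; apply: contraT; rewrite negb_or => /andP[ak xk].
suff e : k = j by rewrite e eqxx in kj.
have jk : w ord0 j <= w ord0 k by have /jmin : k \in supp x by rewrite inE.
by apply: w_inj; apply: le_anti; rewrite jk jmax ?inE.
Qed.

Lemma dim_nonleading L : \dim L = #|nonleading L|.
Proof.
pose f := linfun (@mxsub K 1 n 1 _ id (@enum_val _ (mem (nonleading L)))).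
have ker : (L :&: lker f = 0)%VS.
  apply/eqP; rewrite -subv0; apply/subvP => x.
  rewrite memv_cap memv_ker lfunE /= memv0 => /andP[Lx /eqP /rowP hx].
  apply/eqP/(nonleading_inj Lx) => j Bj.
  by have := hx (enum_rank_in Bj j); rewrite !mxE enum_rankK_in.
have im : (f @: L = fullv)%VS.
  apply/vspaceP => y; rewrite memvf; apply/memv_imgP.
  have [x Lx ex] := nonleading_onto L
    (\sum_k y ord0 k *: unit_row K (enum_val k)).
  exists x => //; rewrite lfunE /=; apply/rowP => k.
  rewrite mxE ex ?enum_valP // summxE (bigD1 k) //= mxE unit_rowE eqxx mulr1.
  rewrite big1 ?addr0 // => l lk; rewrite mxE unit_rowE.
  by rewrite (inj_eq enum_val_inj) eq_sym (negPf lk) mulr0.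
have := limg_ker_dim f L; rewrite ker im dimv0 dimvf /dim /= mul1n.
by [].
Qed.

(** Induction on the size of [I]: a face through the heaviest [i] is extended in L/i, any other face
    in L\i. *)
Lemma complex_pure I L tau : tau \in Delta L I -> (#|tau| <= \dim L)%N /\
  exists tau', [/\ tau \subset tau', tau' \in Delta L I & #|tau'| = \dim L].
Proof.
move: {2}#|I| (erefl #|I|) => m; elim: m => [|m IH] in I L tau *.
  move=> /cards0_eq ->; rewrite !complex_set0E => tB.
  by rewrite dim_nonleading subset_leq_card //; split=> //; exists (nonleading L);
    rewrite complex_set0E.
move=> cI; have [k0 Ik0] : exists k, k \in I by apply/set0Pn; rewrite -card_gt0 cI.
have [i /wmaxP[Ii imax]] := wmax_neq0 w Ik0 => tD.
have iL : ~ is_loop L i by move=> iL; rewrite (complex_loop _ Ii iL) inE in tD.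
have cI' : #|I :\ i| = m by move: cI; rewrite (cardsD1 i) Ii => -[].
have iI' : i \notin I :\ i by rewrite !inE eqxx.
have dimL := dim_contraction iL.
have con (sigma : {set 'I_n}) : i \notin sigma -> i |: sigma \in Delta L I ->
    (#|sigma| < \dim L)%N /\ exists tau', [/\ i |: sigma \subset tau',
      tau' \in Delta L I & #|tau'| = \dim L].
  move=> isg; rewrite (complex_contraction w_inj Ii imax iL) // => /(IH _ _ _ cI').
  move=> [sle [t [st tC tc]]]; rewrite dimL ltnS; split=> //.
  have it := complex_loop_notin iI' (@is_loop_contraction _ _ _ _) tC.
  exists (i |: t); rewrite setUS // (complex_contraction w_inj Ii imax iL) //.
  by rewrite cardsU1 it tc.
case: (boolP (i \in tau)) => it.
  have := con _ (negbT (setD11 i tau)); rewrite setD1K // => /(_ tD)[sle ext].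
  by rewrite (cardsD1 i) it.
have := tD; rewrite (complex_deletion w_inj Ii imax iL) //.
(* Deleting a coloop lowers the dimension. But then L\i = L/i, so [i |: tau] is also a face and the
   first case applies to it. *)
case: (boolP (is_coloop L i)) => coi.
  rewrite deletion_coloop // -(complex_contraction w_inj Ii imax iL) // => /(con _ it).
  move=> [/ltnW-> [t [st tC tc]]]; split=> //; exists t; split=> //.
  exact: subset_trans (subsetUr _ _) st.
move=> /(IH _ _ _ cI'); rewrite dim_deletion // => -[-> [t [st tC tc]]].
split=> //; exists t; split=> //; rewrite (complex_deletion w_inj Ii imax iL) //.
exact: complex_loop_notin iI' (@is_loop_deletion _ _ _ _) tC.
Qed.

(** By purity this is the number of facets. Prescribing the size, instead of maximality, lets the
    count pass to the minors. *)
Definition nbfacets L I := #|[set tau in Delta L I | #|tau| == \dim L]|.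

Lemma facetsE L I :
  facets (Delta L I) = [set tau in Delta L I | #|tau| == \dim L].
Proof.
apply/setP => tau; rewrite /facets in_set [RHS]in_set.
apply/maxsetP/andP => [[tD tmax]|[tD /eqP tc]].
  split=> //; have [_ [t [st tD' tc]]] := complex_pure tD.
  by rewrite -(tmax t tD' st) tc.
split=> // t tD' st; apply/esym/eqP; rewrite eqEcard st tc.
by case: (complex_pure tD').
Qed.

Lemma nbfacets_set0 L : nbfacets L set0 = 1%N.
Proof.
rewrite -(cards1 (nonleading L)); apply: eq_card => tau.
rewrite in_set complex_set0E dim_nonleading in_set1.
apply/andP/eqP => [[tB /eqP tc]|->]; last by rewrite subxx eqxx.
by apply/eqP; rewrite eqEcard tB tc /=.
Qed.

Lemma nbfacets_loop L I i : i \in I -> is_loop L i -> nbfacets L I = 0%N.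
Proof.
move=> Ii iL; apply/eqP; rewrite cards_eq0; apply/eqP/setP => tau.
by rewrite inE (complex_loop w Ii iL) !inE.
Qed.

Section Recursion.
Variables (L : {vspace 'rV[K]_n}) (I : {set 'I_n}) (i : 'I_n).
Hypotheses (Ii : i \in I) (imax : forall k, k \in I -> w ord0 k <= w ord0 i).
Hypothesis iL : ~ is_loop L i.

Let iI' : i \notin I :\ i.
Proof. by rewrite !inE eqxx. Qed.

Let nbfacets_con :
  nbfacets (contraction L i) (I :\ i) =
  #|[set A : {set 'I_n} |
      (i \notin A) && ((i |: A \in Delta L I) && (#|i |: A| == \dim L))]|.
Proof.
apply: eq_card => A; rewrite in_set [RHS]in_set.
case: (boolP (i \in A)) => iA.
  apply/negbTE/negP => /andP[+ _].
  by move=> /(complex_loop_notin iI' (@is_loop_contraction _ _ _ _)); rewrite iA.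
rewrite (complex_contraction w_inj Ii imax iL) //=.
by rewrite (dim_contraction iL) cardsU1 iA eqSS.
Qed.

(** A face without [i] is a face of L\i = L/i, hence too small to be a facet. *)
Lemma nbfacets_coloop : is_coloop L i ->
  nbfacets L I = nbfacets (contraction L i) (I :\ i).
Proof.
move=> coi; rewrite nbfacets_con /nbfacets (card_split i) -[RHS]addn0.
congr (_ + _)%N; apply/eqP; rewrite cards_eq0; apply/eqP/setP => A.
rewrite in_set0 in_set; apply/negbTE/negP => /and3P[iA AD /eqP Ac].
move: AD; rewrite (complex_deletion w_inj Ii imax iL) // deletion_coloop //.
by case/complex_pure; rewrite Ac (dim_contraction iL) ltnn.
Qed.

Lemma nbfacets_rec : ~~ is_coloop L i ->
  nbfacets L I =
  (nbfacets (contraction L i) (I :\ i) + nbfacets (deletion L i) (I :\ i))%N.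
Proof.
move=> coi; rewrite nbfacets_con /nbfacets (card_split i); congr (_ + _)%N.
apply: eq_card => A; rewrite in_set [RHS]in_set dim_deletion //.
case: (boolP (i \in A)) => iA /=; last by rewrite -(complex_deletion w_inj Ii imax iL).
apply/esym/negbTE/negP => /andP[+ _].
by move=> /(complex_loop_notin iI' (@is_loop_deletion _ _ _ _)); rewrite iA.
Qed.

End Recursion.

End Purity.

(** * Counting sign vectors *)

Section RegionCount.
Variables (R : realType) (n : nat).
Implicit Types (V : 'rV[R]_n -> Prop) (u v x y : 'rV[R]_n) (i j : 'I_n).
Implicit Types (I J : {set 'I_n}).

Definition linear_pred V := V 0 /\ forall c x y, V x -> V y -> V (c *: x + y).

(* A set J encodes the sign vector that is positive on J and negative
   elsewhere; only its values on I matter. *)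
Definition sgn_of J j : R := if j \in J then 1 else -1.

Definition cell V u I J x :=
  V (x - u) /\ forall j, j \in I -> 0 < sgn_of J j * x ord0 j.

(** For a nonempty cell this is its recession cone intersected with R^I. *)
Definition cone V I J v :=
  [/\ V v, forall j, j \notin I -> v ord0 j = 0
    & forall j, j \in I -> 0 <= sgn_of J j * v ord0 j].

(** The condition [J \subset I] leaves exactly one [J] for each sign vector on [I]. *)
Definition counted V u I J :=
  [&& J \subset I, `[< exists x, cell V u I J x >]
    & `[< forall v, cone V I J v -> v = 0 >]].

Definition nbcells V u I := #|[set J | counted V u I J]|.

Lemma nbcells_set0 V u : V 0 -> nbcells V u set0 = 1%N.
Proof.
move=> V0; rewrite -(cards1 (set0 : {set 'I_n})); apply: eq_card => J.
rewrite in_set in_set1 /counted subset0; case: eqP => //= _.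
apply/andP; split; apply/asboolP.
  by exists u; split=> [|j]; rewrite ?subrr // in_set0.
by move=> v [_ h _]; apply/row0P => j; rewrite h ?in_set0 // mxE.
Qed.

(** Every cone contains [unit_row R i] or its opposite. *)
Lemma nbcells_loop V u I i :
  linear_pred V -> i \in I -> V (unit_row R i) -> nbcells V u I = 0%N.
Proof.
move=> [V0 Vlin] Ii Vi; apply/eqP; rewrite cards_eq0; apply/eqP/setP => J.
rewrite in_set in_set0; apply/negbTE/negP => /and3P[_ _ /asboolP h].
have /eqP : sgn_of J i *: unit_row R i = 0.
  apply: h; split=> [|j|j _]; first by rewrite -[X in V X]addr0; apply: Vlin.
    by rewrite mxE unit_rowE; case: eqP => [->|]; rewrite ?Ii ?mulr0.
  rewrite mxE unit_rowE; case: eqP => [->|]; last by rewrite !mulr0.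
  by rewrite mulr1 -expr2 sqr_ge0.
rewrite scaler_eq0 (negPf (unit_row_neq0 _ _)) orbF /sgn_of.
by case: ifP => _; rewrite ?oppr_eq0 oner_eq0.
Qed.

Lemma small_step (A : {pred 'I_n}) (a b : 'I_n -> R) :
  (forall j, j \in A -> 0 < a j) ->
  exists2 e, 0 < e & forall j, j \in A -> 0 < a j + e * b j.
Proof.
(* Each quotient [|b j| / a j] is one term of [s], so the single step 1/s is short enough for all
   [j] at once. *)
move=> apos; pose s := 1 + \sum_(j in A) `|b j| / a j.
have s0 : 0 < s.
  by rewrite ltr_pwDl // sumr_ge0 // => j Aj; rewrite divr_ge0 // ltW ?apos.
exists s^-1 => [|j Aj]; first by rewrite invr_gt0.
have aj := apos j Aj.
suff : s^-1 * `|b j| < a j.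
  move=> lt; rewrite -ltrBlDr sub0r; apply: le_lt_trans lt.
  rewrite -mulrN; apply: ler_wpM2l; first by rewrite invr_ge0 ltW.
  by rewrite -normrN ler_norm.
rewrite mulrC ltr_pdivrMr // mulrC -ltr_pdivrMr // /s (bigD1 j) //=.
rewrite addrCA ltrDl ltr_pwDl // sumr_ge0 // => k /andP[Ak _].
by rewrite divr_ge0 // ltW ?apos.
Qed.

(** * Erasing a hyperplane and restricting to it *)

Section Recursion.
Variables (V : 'rV[R]_n -> Prop) (u : 'rV[R]_n) (I : {set 'I_n}) (i : 'I_n).
Hypotheses (Vlin : linear_pred V) (Ii : i \in I) (Vi : ~ V (unit_row R i)).

(** When [V] is the perp of [L], this is the perp of L/i, and [V'] below is the perp of L\i. *)
Let Vc v := exists c, V (v - c *: unit_row R i).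

Let V0 : V 0. Proof. by case: Vlin. Qed.
Let VZ c x : V x -> V (c *: x).
Proof. by move=> Vx; rewrite -[X in V X]addr0; case: Vlin => _; apply. Qed.
Let VD x y : V x -> V y -> V (x + y).
Proof. by move=> Vx Vy; rewrite -[x]scale1r; case: Vlin => _; apply. Qed.

Section FixedSigns.
Variable J : {set 'I_n}.
Hypothesis iJ : i \notin J.

(* P is the cell with the hyperplane x_i = 0 erased, C its cone. N s says that
   P meets the side s x_i > 0, and B s that C has no nonzero vector on the
   side s v_i >= 0. *)
Let P x := V (x - u) /\ forall j, j \in I :\ i -> 0 < sgn_of J j * x ord0 j.

Let C v := [/\ V v, forall j, j \notin I -> v ord0 j = 0
  & forall j, j \in I :\ i -> 0 <= sgn_of J j * v ord0 j].

Let N (s : R) := exists2 x, P x & 0 < s * x ord0 i.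
Let B (s : R) := forall v, C v -> 0 <= s * v ord0 i -> v = 0.

Let sgn_U1 j : j \in I :\ i -> sgn_of (i |: J) j = sgn_of J j.
Proof. by rewrite in_setD1 /sgn_of in_setU1 => /andP[/negPf ->]. Qed.

Let sgnNE : sgn_of J i = -1. Proof. by rewrite /sgn_of (negPf iJ). Qed.
Let sgnPE : sgn_of (i |: J) i = 1. Proof. by rewrite /sgn_of setU11. Qed.

Let all_split (Q : 'I_n -> Prop) :
  (forall j, j \in I -> Q j) <-> ((forall j, j \in I :\ i -> Q j) /\ Q i).
Proof.
split=> [h|[h Qi] j Ij].
  by split=> [j|]; [rewrite in_setD1 => /andP[_]|]; apply: h.
by case: (eqVneq j i) => [->//|ji]; apply: h; rewrite in_setD1 ji.
Qed.

Let counted_neg : counted V u I J =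
  [&& J \subset I :\ i, `[< N (-1) >] & `[< B (-1) >]].
Proof.
rewrite /counted subsetD1 iJ andbT; congr [&& _, _ & _]; apply: asbool_equiv_eq.
  split=> [[x [Vx /all_split[h]]]|[x [Vx h] xi]].
    by rewrite sgnNE; exists x.
  by exists x; split=> //; apply/all_split; rewrite sgnNE.
split=> h v; last by case=> Vv v0 /all_split[h1]; rewrite sgnNE; apply: h.
by move=> [Vv v0 h1] vi; apply: h; split=> //; apply/all_split; rewrite sgnNE.
Qed.

Let counted_pos : counted V u I (i |: J) =
  [&& J \subset I :\ i, `[< N 1 >] & `[< B 1 >]].
Proof.
have sI : (i |: J \subset I) = (J \subset I :\ i).
  by rewrite subUset sub1set Ii subsetD1 iJ andbT.
have ltJ x : (forall j, j \in I :\ i -> 0 < sgn_of (i |: J) j * x ord0 j) <->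
  (forall j, j \in I :\ i -> 0 < sgn_of J j * x ord0 j).
  by split=> h j Ij; have := h j Ij; rewrite sgn_U1.
have leJ x : (forall j, j \in I :\ i -> 0 <= sgn_of (i |: J) j * x ord0 j) <->
  (forall j, j \in I :\ i -> 0 <= sgn_of J j * x ord0 j).
  by split=> h j Ij; have := h j Ij; rewrite sgn_U1.
rewrite /counted sI; congr [&& _, _ & _]; apply: asbool_equiv_eq.
  split=> [[x [Vx /all_split[/ltJ h]]]|[x [Vx h] xi]].
    by rewrite sgnPE; exists x.
  by exists x; split=> //; apply/all_split; rewrite sgnPE; split=> //; apply/ltJ.
split=> h v; last first.
  by case=> Vv v0 /all_split[/leJ h1]; rewrite sgnPE; apply: h.
move=> [Vv v0 h1] vi; apply: h; split=> //; apply/all_split; rewrite sgnPE.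
by split=> //; apply/leJ.
Qed.

Let counted_con : counted Vc u (I :\ i) J =
  [&& J \subset I :\ i, `[< exists x, P x >] & `[< forall v, C v -> v = 0 >]].
Proof.
have coordB x c j : j \in I :\ i ->
    (x - c *: unit_row R i) ord0 j = x ord0 j.
  rewrite in_setD1 !mxE eqxx /= => /andP[/negPf -> _].
  by rewrite mulr0 subr0.
rewrite /counted; congr [&& _, _ & _]; apply: asbool_equiv_eq.
  split=> [[x [[c Vx] h]]|[x [Vx h]]].
    exists (x - c *: unit_row R i); split; first by rewrite addrAC.
    by move=> j Ij; rewrite coordB //; apply: h.
  by exists x; split=> //; exists 0; rewrite scale0r subr0.
split=> h v.
  move=> [Vv v0 h1]; have /h e : cone Vc (I :\ i) J (v - v ord0 i *: unit_row R i).
    split=> [|j|j Ij]; last by rewrite coordB // h1.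
      by exists (- v ord0 i); rewrite scaleNr opprK subrK.
    rewrite in_setD1 !mxE negb_and negbK eqxx; case: eqP => [->|_] /=.
      by rewrite mulr1 subrr.
    by rewrite mulr0 subr0; apply: v0.
  (* Now [v] is a multiple of [unit_row R i]; a nonzero multiple would put this vector in [V]. *)
  move/eqP: e; rewrite subr_eq0 => /eqP e; case: (eqVneq (v ord0 i) 0) => [vi|vi].
    by rewrite e vi scale0r.
  by case: Vi; rewrite -[unit_row _ _](scalerK vi) -e; apply: VZ.
move=> [[c Vv] v0 h1].
have e : v - c *: unit_row R i = 0.
  apply: h; split=> // [j|j Ij]; last by rewrite coordB // h1.
  move=> jI; have ji : j != i by apply: contraNneq jI => ->.
  by rewrite !mxE eqxx (negPf ji) mulr0 subr0 v0 // in_setD1 negb_and jI orbT.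
move/eqP: e; rewrite subr_eq0 => /eqP e; rewrite e.
have := v0 i; rewrite in_setD1 eqxx => /(_ isT).
by rewrite e mxE unit_rowE eqxx mulr1 => ->; rewrite scale0r.
Qed.

(** On the whole affine space the i-th coordinate equals [u ord0 i], so the hyperplane cuts no cell,
    and the sign of [u ord0 i] decides which of the two terms on the left can be nonzero. *)
Lemma counted_coloop :
  (forall v, V v -> v ord0 i = 0) -> u ord0 i != 0 ->
  (counted V u I (i |: J) + counted V u I J = counted Vc u (I :\ i) J)%N.
Proof.
move=> Vi0 ui; rewrite counted_pos counted_neg counted_con.
case: (J \subset I :\ i) => //=.
have Px x : P x -> x ord0 i = u ord0 i.
  by case=> /Vi0; rewrite !mxE => /eqP; rewrite subr_eq0 => /eqP.
have Be s : `[< B s >] = `[< forall v, C v -> v = 0 >].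
  apply: asbool_equiv_eq; split=> h v Cv; last by move=> _; apply: h.
  by apply: h => //; case: Cv => /Vi0 -> _ _; rewrite mulr0.
have Ne s : 0 < s * u ord0 i -> `[< N s >] = `[< exists x, P x >].
  move=> su; apply: asbool_equiv_eq; split=> [[x Px' _]|[x Px']]; exists x => //.
  by rewrite Px.
have Nn s : ~~ (0 < s * u ord0 i) -> `[< N s >] = false.
  move=> su; apply/negbTE/negP => /asboolP[x Px']; rewrite Px //.
  by apply/negP.
rewrite !Be; case: (ltrgt0P (u ord0 i)) ui => // ui _.
  by rewrite (Ne 1) ?mul1r // (Nn (-1)) ?addn0 // mulN1r oppr_gt0 -leNgt ltW.
by rewrite (Ne (-1)) ?mulN1r ?oppr_gt0 // (Nn 1) // mul1r -leNgt ltW.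
Qed.

Variable d : 'rV[R]_n.
Hypotheses (Vd : V d) (di : d ord0 i = 1).

Let V' v := V (mask [set~ i] v).
(** Modulo [V], the point [u] may be replaced by [u - u ord0 i *: d], which lies on x_i = 0 and
    agrees with [u'] off [i]. The i-th coordinate is invisible to [V']; masking [d] turns the
    passage from [u] to [u'] into a shear. *)
Let u' := u - u ord0 i *: mask [set~ i] d.

Let N0 := exists2 x, P x & x ord0 i = 0.
Let B0 := forall v, C v -> v ord0 i = 0 -> v = 0.

Let maskE' x j : j \in I :\ i -> mask [set~ i] x ord0 j = x ord0 j.
Proof. by rewrite maskE !inE => /andP[-> _]. Qed.

Let maskC1_id (x : 'rV[R]_n) : x ord0 i = 0 -> mask [set~ i] x = x.
Proof. by move=> xi; rewrite maskC1E xi scale0r subr0. Qed.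

Let VB x y : V (x + y) -> V y -> V x.
Proof.
by move=> Vxy Vy; rewrite -(addrK y x) -scaleN1r; apply: VD => //; apply: VZ.
Qed.

Let counted_del : counted V' u' (I :\ i) J =
  [&& J \subset I :\ i, `[< N0 >] & `[< B0 >]].
Proof.
have eu x : mask [set~ i] (x - u') = mask [set~ i] x - u + u ord0 i *: d.
  apply/row0P => j; rewrite !(maskE, mxE) !inE.
  case: eqP => [->|_] /=; first by rewrite di mulr1 sub0r addNr.
  by rewrite opprB addrA addrAC.
rewrite /counted; congr [&& _, _ & _]; apply: asbool_equiv_eq.
  split=> [[x [V'x h]]|[x [Vx h] xi]].
    exists (mask [set~ i] x); last by rewrite maskE !inE eqxx.
    split=> [|j Ij]; last by rewrite maskE' //; apply: h.
    by apply: VB (VZ (u ord0 i) Vd); rewrite -eu.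
  exists x; split=> //; rewrite /V' eu maskC1_id //.
  exact/VD/VZ.
split=> h v.
  move=> [Vv v0 h1] vi; apply: h; split=> //; first by rewrite /V' maskC1_id.
  by move=> j; case: (eqVneq j i) => [->//|ji]; rewrite in_setD1 ji => /v0.
move=> [V'v v0 h1].
have vi : v ord0 i = 0 by apply: v0; rewrite in_setD1 eqxx.
apply: h => //; split=> [|j jI|//]; first by rewrite -(maskC1_id vi).
by apply: v0; rewrite in_setD1 negb_and jI orbT.
Qed.

Let P_step x v t : P x -> V v -> exists2 e, 0 < e & P (x + (e * t) *: v).
Proof.
move=> [Vx h] Vv.
have [e e0 he] := small_step (fun j => sgn_of J j * (t * v ord0 j)) h.
exists e => //; split=> [|j Ij]; first by rewrite addrAC; apply/VD/VZ.
by rewrite !mxE mulrDr -mulrA mulrCA; apply: he.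
Qed.

(** The direction [d] crosses the hyperplane, and a short move along it stays in the open set
    [P]. *)
Let N_of_N0 s : s * s = 1 -> N0 -> N s.
Proof.
move=> ss [x Px xi]; have [e e0 Pe] := P_step s Px Vd.
exists (x + (e * s) *: d) => //.
by rewrite !mxE xi di add0r mulr1 mulrCA ss mulr1.
Qed.

Let N0_of_N : N 1 -> N (-1) -> N0.
Proof.
move=> [x [Vx hx]]; rewrite mul1r => xi [y [Vy hy]]; rewrite mulN1r oppr_gt0 => yi.
pose c := x ord0 i - y ord0 i.
have c0 : 0 < c by rewrite subr_gt0 (lt_trans yi).
(* This is the point where the segment from [y] to [x] crosses x_i = 0: the two coefficients are
   positive and add up to 1. *)
exists ((x ord0 i / c) *: y - (y ord0 i / c) *: x); last first.
  by rewrite !mxE; field; rewrite gt_eqF.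
split=> [|j Ij].
  have -> : (x ord0 i / c) *: y - (y ord0 i / c) *: x - u =
      (x ord0 i / c) *: (y - u) + (- (y ord0 i / c)) *: (x - u).
    by apply/row0P => j; rewrite !mxE /c; field; rewrite gt_eqF.
  by apply: VD; apply: VZ.
have -> : sgn_of J j * ((x ord0 i / c) *: y - (y ord0 i / c) *: x) ord0 j =
    (x ord0 i * (sgn_of J j * y ord0 j) - y ord0 i * (sgn_of J j * x ord0 j)) / c.
  by rewrite !mxE; field; rewrite gt_eqF.
rewrite divr_gt0 // subr_gt0 (@lt_trans _ _ 0) //.
  by rewrite pmulr_llt0 // hx.
by rewrite mulr_gt0 // hy.
Qed.

Let B0_of_B s : B s -> B0.
Proof. by move=> Bs v Cv vi; apply: Bs => //; rewrite vi mulr0. Qed.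

Let NB_not s : ~ B s -> exists v, [/\ C v, 0 <= s * v ord0 i & v <> 0].
Proof.
move=> /existsNP[v /not_implyP[Cv /not_implyP[sv v0]]].
by exists v.
Qed.

(** Nonzero vectors of [C] on the two sides combine to a vector [z] of [C] on the hyperplane, so [z]
    is 0. Off [i], each coordinate of [z] is a sum of two terms of the same sign, so both vanish;
    then [v] is a multiple of [unit_row R i], which is not in [V]. *)
Let B_of_B0 : B0 -> B 1 \/ B (-1).
Proof.
move=> b0; apply: contrapT => /not_orP[/NB_not[v [Cv]]].
rewrite mul1r => vi v0 /NB_not[v' [Cv']]; rewrite mulN1r oppr_ge0 => v'i v'0.
have [Vv vI hv] := Cv; have [Vv' v'I hv'] := Cv'.
pose z := v ord0 i *: v' - v' ord0 i *: v.
have zE j : z ord0 j = v ord0 i * v' ord0 j - v' ord0 i * v ord0 j.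
  by rewrite !mxE.
have Cz : C z.
  split=> [|j jI|j Ij]; first by rewrite /z -scaleNr; apply: VD; apply: VZ.
    by rewrite zE (vI j) // (v'I j) // !mulr0 subrr.
  rewrite zE mulrBr !(mulrCA (sgn_of J j)) subr_ge0 (@le_trans _ _ 0) //.
    by rewrite mulr_le0_ge0 // hv.
  by rewrite mulr_ge0 // hv'.
have /row0P z0 : z = 0 by apply: b0 => //; rewrite zE mulrC subrr.
have vi0 : 0 < v ord0 i.
  rewrite lt_def vi andbT; apply/eqP => e.
  by apply: v0; apply: b0.
have v'i0 : v' ord0 i < 0.
  rewrite lt_def v'i andbT; apply/eqP => e.
  by apply: v'0; apply: b0.
have vj j : j != i -> v ord0 j = 0.
  move=> ji; have [Ij|/vI//] := boolP (j \in I).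
  have Iji : j \in I :\ i by rewrite in_setD1 ji.
  have := z0 j; rewrite zE mxE => /eqP; rewrite subr_eq0 => /eqP e.
  have hj := hv j Iji; have hj' := hv' j Iji.
  have e0 : v' ord0 i * (sgn_of J j * v ord0 j) = 0.
    apply: le_anti; rewrite mulr_le0_ge0 //= mulrCA -e mulrCA.
    by rewrite mulr_ge0.
  move/eqP: e0; rewrite mulf_eq0 (lt_eqF v'i0) mulf_eq0 /sgn_of /=.
  by case: ifP => _; rewrite ?oppr_eq0 oner_eq0 => /eqP.
apply: Vi; have -> : unit_row R i = (v ord0 i)^-1 *: v; last exact: VZ.
apply/row0P => j; rewrite !mxE eqxx /=; case: eqP => [->|/eqP/vj ->].
  by rewrite mulVf // gt_eqF.
by rewrite mulr0.
Qed.

(** From a point of [P] on the side [s], follow a vector of [C] pointing to the other side: the ray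
    stays in [P] and meets the hyperplane, against [~ N0]. A vector parallel to the hyperplane
    contradicts [B s] directly. *)
Let ray s : N s -> ~ N0 -> ~ B (- s) -> ~ B s.
Proof.
move=> [x [Vx hx] xi] nN0 /NB_not[v [Cv vi v0]] Bs.
have [Vv vI hv] := Cv; move: vi; rewrite mulNr oppr_ge0 le_eqVlt.
case/orP => [/eqP vi|vi]; first by apply: v0; apply: Bs => //; rewrite vi.
have s0 : s != 0 by apply: contraTneq vi => ->; rewrite mul0r ltxx.
have vi0 : v ord0 i != 0 by apply: contraTneq vi => ->; rewrite mulr0 ltxx.
pose t := - (x ord0 i / v ord0 i).
have t0 : 0 < t.
  have -> : t = (s * x ord0 i) / - (s * v ord0 i).
    by rewrite /t; field; rewrite s0 vi0.
  by rewrite divr_gt0 // oppr_gt0.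
apply: nN0; exists (x + t *: v); last by rewrite !mxE /t; field.
split=> [|j Ij]; first by rewrite addrAC; apply/VD/VZ.
by rewrite !mxE mulrDr mulrCA ltr_pwDl ?hx // mulr_ge0 ?hv // ltW.
Qed.

(* N 1 and N (-1) both hold iff P meets x_i = 0; B 1 or B (-1) holds iff C
   meets v_i = 0 only in 0. The identity is then propositional. *)
Lemma counted_rec :
  (counted V u I (i |: J) + counted V u I J =
   counted Vc u (I :\ i) J + counted V' u' (I :\ i) J)%N.
Proof.
rewrite counted_pos counted_neg counted_con counted_del.
case: (J \subset I :\ i) => //=.
have Pe : (exists x, P x) <-> N 1 \/ N (-1).
  split=> [[x Px]|]; last by case=> -[x Px _]; exists x.
  case: (ltrgt0P (x ord0 i)) => xi.
  - by left; exists x; rewrite ?mul1r.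
  - by right; exists x; rewrite // mulN1r oppr_gt0.
  - by left; apply: N_of_N0; rewrite ?mulr1 //; exists x.
have Ce : (forall v, C v -> v = 0) <-> B 1 /\ B (-1).
  split=> [h|[h1 h2] v Cv]; first by split=> v /h.
  case: (lerP 0 (v ord0 i)) => vi; first by apply: h1; rewrite ?mul1r.
  by apply: h2; rewrite // mulN1r oppr_ge0 ltW.
rewrite (asbool_equiv_eq Pe) (asbool_equiv_eq Ce) asbool_or asbool_and.
have N0e : N0 <-> N 1 /\ N (-1).
  split=> [h|[]]; last exact: N0_of_N.
  by split; apply: N_of_N0; rewrite ?mulr1 // mulrNN mulr1.
have B0e : B0 <-> B 1 \/ B (-1).
  by split=> [|[]]; [exact: B_of_B0|exact: B0_of_B|exact: B0_of_B].
have rp := @ray 1; have rn := @ray (-1); rewrite opprK in rn.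
move: rp rn; rewrite (asbool_equiv_eq N0e) (asbool_equiv_eq B0e).
rewrite asbool_or asbool_and N0e.
case: (asboolP (N 1)) => n1; case: (asboolP (N (-1))) => n2;
  case: (asboolP (B 1)) => b1; case: (asboolP (B (-1))) => b2 //=; tauto.
Qed.

End FixedSigns.

End Recursion.

End RegionCount.

(** * Recursion for the number of cells, and generic translations *)

Section RegionRecursion.
Variables (R : realType) (n : nat).
Implicit Types (V : 'rV[R]_n -> Prop) (u v x y : 'rV[R]_n) (i j : 'I_n).
Implicit Types (I J : {set 'I_n}).

Lemma card_pred_sum (T : finType) (P : pred T) :
  #|[set A | P A]| = (\sum_A P A)%N.
Proof. by rewrite -sum1dep_card big_mkcond; apply: eq_bigr => A _; case: (P A). Qed.

Lemma nbcells_split V u I i : nbcells V u I =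
  (\sum_(J : {set 'I_n} | i \notin J) (counted V u I (i |: J) + counted V u I J))%N.
Proof.
rewrite /nbcells (card_split i) !card_pred_sum -big_split [RHS]big_mkcond.
by apply: eq_bigr => J _; case: (i \notin J).
Qed.

Lemma nbcells_notin V u I i : nbcells V u (I :\ i) =
  (\sum_(J : {set 'I_n} | i \notin J) counted V u (I :\ i) J)%N.
Proof.
rewrite /nbcells card_pred_sum [RHS]big_mkcond; apply: eq_bigr => J _.
by rewrite /counted subsetD1; case: (i \notin J); rewrite ?andbF.
Qed.

Section Recursion.
Variables (V : 'rV[R]_n -> Prop) (u : 'rV[R]_n) (I : {set 'I_n}) (i : 'I_n).
Hypotheses (Vlin : linear_pred V) (Ii : i \in I) (Vi : ~ V (unit_row R i)).

Lemma nbcells_coloop :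
  (forall v, V v -> v ord0 i = 0) -> u ord0 i != 0 ->
  nbcells V u I = nbcells (fun v => exists c, V (v - c *: unit_row R i)) u (I :\ i).
Proof.
move=> Vi0 ui; rewrite (nbcells_split _ _ _ i) nbcells_notin.
by apply: eq_bigr => J iJ; apply: counted_coloop.
Qed.

Lemma nbcells_rec d : V d -> d ord0 i = 1 ->
  nbcells V u I = (nbcells (fun v => exists c, V (v - c *: unit_row R i)) u (I :\ i) +
    nbcells (fun v => V (mask [set~ i] v))
      (u - u ord0 i *: mask [set~ i] d) (I :\ i))%N.
Proof.
move=> Vd di; rewrite (nbcells_split _ _ _ i) !nbcells_notin -big_split.
by apply: eq_bigr => J iJ; apply: counted_rec.
Qed.

End Recursion.

(* Unlike generically, this is visibly stable under the shear that sends u to a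
   representative of u modulo V on the hyperplane x_i = 0. *)
Definition off_hyperplanes (P : 'rV[R]_n -> Prop) :=
  exists s : seq 'rV[R]_n, (forall a, a \in s -> a != 0) /\
    forall u, (forall a, a \in s -> dot a u != 0) -> P u.

Lemma off_hyperplanesT (P : 'rV[R]_n -> Prop) :
  (forall u, P u) -> off_hyperplanes P.
Proof. by move=> h; exists [::]; split. Qed.

Lemma off_hyperplanes_coord i : off_hyperplanes (fun u => u ord0 i != 0).
Proof.
exists [:: unit_row R i]; split=> [a|u h]; last first.
  by rewrite -(dot_unit i u); apply: h; rewrite mem_head.
by rewrite mem_seq1 => /eqP ->; apply: unit_row_neq0.
Qed.

Lemma off_hyperplanes2 (P Q S : 'rV[R]_n -> Prop) :
  (forall u, P u -> Q u -> S u) ->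
  off_hyperplanes P -> off_hyperplanes Q -> off_hyperplanes S.
Proof.
move=> PQS [s [s0 hs]] [t [t0 ht]]; exists (s ++ t); split=> [a|u h].
  by rewrite mem_cat => /orP[/s0|/t0].
by apply: PQS; [apply: hs|apply: ht] => a ain; apply: h; rewrite mem_cat ain ?orbT.
Qed.

(** Pulled back along the shear, the normal [a] becomes [a - dot a d *: unit_row R i]. As [d] has
    i-th coordinate 0, this vanishes only if [a] does. *)
Lemma off_hyperplanes_shear i (d : 'rV[R]_n) (P : 'rV[R]_n -> Prop) : d ord0 i = 0 ->
  off_hyperplanes P -> off_hyperplanes (fun u => P (u - u ord0 i *: d)).
Proof.
move=> di [s [s0 hs]]; exists [seq a - dot a d *: unit_row R i | a <- s].
split=> [b /mapP[a /s0 a0 ->]|u h]; last first.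
  apply: hs => a sa; have := h _ (map_f _ sa).
  by rewrite dotBl dotBr dotZl dotZr dot_unit mulrC.
apply: contra a0; rewrite subr_eq0 => /eqP e.
have ad : dot a d = 0 by rewrite e dotZl dot_unit di mulr0.
by rewrite e ad scale0r.
Qed.

(** The product of the linear forms is a nonzero polynomial, since each factor is nonzero at some
    unit vector. *)
Lemma off_hyperplanes_generically (P : 'rV[R]_n -> Prop) :
  off_hyperplanes P -> generically P.
Proof.
move=> [s [s0 hs]].
pose f (a : 'rV[R]_n) : mpoly n R := \sum_j a ord0 j *: mpolyX R (mnm1 j).
have fE a u : peval (f a) u = dot a u.
  rewrite /peval linear_sum; apply: eq_bigr => j _.
  by rewrite linearZ /= mevalXU.
exists (\prod_(a <- s) f a).
  rewrite prodf_seq_neq0; apply/allP => a sa /=.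
  have /rV0Pn[j aj] := s0 a sa; apply: contra aj => /eqP.
  move=> /(congr1 (fun p => peval p (unit_row R j))).
  by rewrite fE dotC dot_unit /peval meval0 => ->.
move=> u; rewrite /peval rmorph_prod prodf_seq_neq0 => /allP h.
by apply: hs => a sa; rewrite -fE; have := h a sa.
Qed.

End RegionRecursion.

(** * Real points of the perp, and equality of the two counts *)

Section RealPerp.
Variables (R : realType) (n : nat) (w : 'rV[R]_n).
Hypothesis w_inj : injective (w ord0).
Local Notation K := R[i].
Local Notation rc := (map_mx (real_complex R)).
Local Notation cj := (map_mx (@conjc R)).
Implicit Types (L : {vspace 'rV[K]_n}) (a x : 'rV[K]_n) (v : 'rV[R]_n) (i : 'I_n).

Local Notation realperp L := (fun v : 'rV[R]_n => perp L (rc v)).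

Lemma realperp_linear L : linear_pred (realperp L).
Proof.
split=> [|c x y xL yL]; last by rewrite map_mxD map_mxZ; apply/perpD/yL/perpZ.
by rewrite map_mx0 => x _; apply: big1 => j _; rewrite mxE mul0r.
Qed.

Lemma rc_unit i : rc (unit_row R i) = unit_row K i.
Proof. exact: map_delta_mx. Qed.

Lemma rc_mask (B : {set 'I_n}) v : rc (mask B v) = mask B (rc v).
Proof. by apply/row0P => j; rewrite !mxE; case: ifP => _; rewrite ?rmorph0. Qed.

Lemma cj_rc v : cj (rc v) = rc v.
Proof. by apply/row0P => j; rewrite !mxE conjc_real. Qed.

Lemma cj_unit i : cj (unit_row K i) = unit_row K i.
Proof. exact: map_delta_mx. Qed.

Lemma cj_mask (B : {set 'I_n}) a : cj (mask B a) = mask B (cj a).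
Proof. by apply/row0P => j; rewrite !mxE; case: ifP => _; rewrite ?rmorph0. Qed.

Lemma conj_contraction L i :
  conj_invariant L -> conj_invariant (contraction L i).
Proof.
move=> hL x; rewrite !mem_contraction => /andP[/hL -> /eqP xi] /=.
by rewrite mxE xi conjc0.
Qed.

Lemma conj_deletion L i : conj_invariant L -> conj_invariant (deletion L i).
Proof.
move=> hL x /mem_deletion[y Ly ->]; apply/mem_deletion.
by exists (cj y); [exact: hL|rewrite cj_mask].
Qed.

Lemma perp_conj L a : conj_invariant L -> perp L a -> perp L (cj a).
Proof.
move=> hL aL x /hL /aL /(congr1 (@conjc R)); rewrite conjc0 rmorph_sum => e.
by rewrite -[RHS]e; apply: eq_bigr => j _; rewrite !mxE rmorphM /= conjcK.
Qed.

(** Only the reality of [c] is at stake. Subtracting the form from its conjugate shows that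
    [c - conjc c] times x_i vanishes on [L], and [i] is not a loop. *)
Lemma realperp_contraction L i : conj_invariant L -> ~ is_loop L i ->
  realperp (contraction L i) = fun v => exists c, perp L (rc (v - c *: unit_row R i)).
Proof.
move=> hL iL; apply/funext => v; apply/propext; rewrite perp_contraction //.
split=> [[c vL]|[c vL]]; last first.
  by exists c%:C%C; rewrite map_mxB map_mxZ rc_unit in vL.
exists (complex.Re c); rewrite map_mxB map_mxZ rc_unit /=.
suff -> : (real_complex R (complex.Re c)) = c by [].
apply/eqP; apply: contrapT => /negP cr; apply: iL.
have := perpB (perp_conj hL vL) vL.
have -> : cj (rc v - c *: unit_row K i) - (rc v - c *: unit_row K i) =
    (c - conjc c) *: unit_row K i.
  rewrite map_mxB map_mxZ cj_rc cj_unit opprB addrC addrA addrNK.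
  by rewrite scalerBl.
move=> /(perpZ (c - conjc c)^-1); rewrite scalerK //.
apply: contra cr; case: c {vL} => a b; rewrite subr_eq0 !eq_complex /= eqxx /=.
move=> /eqP e; rewrite eq_sym; apply/eqP.
by have : b *+ 2 = 0; [rewrite mulr2n {2}e subrr|move/eqP; rewrite mulrn_eq0 => /eqP].
Qed.

Lemma realperp_deletion L i :
  realperp (deletion L i) = fun v => perp L (rc (mask [set~ i] v)).
Proof. by apply/funext => v; apply/propext; rewrite perp_deletion rc_mask. Qed.

(** Scale a complex form to have i-th coefficient 1 and take its real part, the mean of the form and
    its conjugate. *)
Lemma realperp_noncoloop L i : conj_invariant L -> ~~ is_coloop L i ->
  exists2 d, perp L (rc d) & d ord0 i = 1.
Proof.
move=> hL /noncoloop_witness[a aL ai].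
have bL : perp L ((a ord0 i)^-1 *: a) by apply: perpZ.
pose d : 'rV[R]_n := \row_j complex.Re (((a ord0 i)^-1 *: a) ord0 j).
exists d; last by rewrite !mxE mulVf.
have -> : rc d = 2^-1 *: ((a ord0 i)^-1 *: a + cj ((a ord0 i)^-1 *: a)).
  have ReE (z : K) : (complex.Re z)%:C%C = 2^-1 * (z + conjc z).
    apply: (canRL (mulKf _)); first by rewrite pnatr_eq0.
    by case: z => x y; rewrite mulr_natl mulr2n /real_complex_def /=; simpc.
  by apply/row0P => j; rewrite ![in RHS]mxE [in LHS]mxE [d _ _]mxE mxE ReE.
by apply/perpZ/perpD/perp_conj.
Qed.

(** Both numbers satisfy the same recursion at the heaviest [i] in [I], with the same initial
    values. The hyperplanes to avoid come from the minors, together with u_i = 0 when [i] is a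
    coloop. *)
Lemma nbcells_generic I L : conj_invariant L ->
  off_hyperplanes (fun u => nbcells (realperp L) u I = nbfacets w L I).
Proof.
move: {2}#|I| (erefl #|I|) => m; elim: m => [|m IH] in I L *.
  move=> /cards0_eq -> hL; apply: off_hyperplanesT => u.
  by rewrite nbfacets_set0 ?nbcells_set0 //; case: (realperp_linear L).
move=> cI hL; have [k0 Ik0] : exists k, k \in I by apply/set0Pn; rewrite -card_gt0 cI.
have [i /wmaxP[Ii imax]] := wmax_neq0 w Ik0.
have cI' : #|I :\ i| = m by move: cI; rewrite (cardsD1 i) Ii => -[].
have [iL|iL] := pselect (is_loop L i).
  apply: off_hyperplanesT => u; rewrite (nbfacets_loop _ Ii iL).
  by apply: nbcells_loop Ii _; [exact: realperp_linear|rewrite rc_unit].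
have iV : ~ perp L (rc (unit_row R i)) by rewrite rc_unit.
have gc := IH _ _ cI' (@conj_contraction _ i hL).
have gd := IH _ _ cI' (@conj_deletion _ i hL).
rewrite realperp_contraction // in gc; rewrite realperp_deletion in gd.
have Vlin := realperp_linear L.
case: (boolP (is_coloop L i)) => coi.
  refine (off_hyperplanes2 _ (@off_hyperplanes_coord _ _ i) gc) => u ui uc.
  rewrite (nbfacets_coloop w_inj Ii imax iL coi) -uc.
  apply: nbcells_coloop => // v /(perp_coloop coi); rewrite mxE.
  by move=> /eqP; rewrite eq_complex /= => /andP[/eqP].
have [d dL di] := realperp_noncoloop hL coi.
have d'i : mask [set~ i] d ord0 i = 0 by rewrite maskE !inE eqxx.
refine (off_hyperplanes2 _ gc (off_hyperplanes_shear d'i gd)) => u uc ud.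
rewrite (nbfacets_rec w_inj Ii imax iL coi) -uc -ud.
exact: (nbcells_rec _ Vlin).
Qed.

End RealPerp.

(** * Regions and their recession cones in terms of sign vectors *)

Section RegionsAreCells.
Local Open Scope classical_set_scope.
Variables (R : realType) (n : nat) (L : {vspace 'rV[R[i]]_n}).
Variables (I : {set 'I_n}) (u : 'rV[R]_n).
Implicit Types (J : {set 'I_n}) (x y v : 'rV[R]_n) (i j : 'I_n).

Let V v := perp L (map_mx (real_complex R) v).
Let S := arrangement_complement (affine_perp L u) I.
Let cellS J : set 'rV[R]_n := [set x | cell V u I J x].
Let signs x : {set 'I_n} := [set j in I | 0 < x ord0 j]%SET.

Let Vlin : linear_pred V. Proof. exact: realperp_linear. Qed.

Let SE x : S x <-> V (x - u) /\ forall i, i \in I -> x ord0 i != 0.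
Proof.
split=> -[Vx x0]; split=> //; last by exists (x - u); rewrite ?subrK.
by case: Vx => v Vv <-; rewrite addrK.
Qed.

Let sgn_ofE J x j : 0 < sgn_of R J j * x ord0 j <->
  (x ord0 j != 0) /\ (j \in J) = (0 < x ord0 j).
Proof.
rewrite /sgn_of; case: (j \in J); rewrite ?mul1r ?mulN1r ?oppr_gt0.
  by split=> [h|[]] //; rewrite h gt_eqF.
split=> [h|[h /esym/negbT]]; first by rewrite lt_eqF // lt_gtF.
by rewrite -leNgt lt_neqAle h.
Qed.

Let cell_sub J x : cellS J x -> S x.
Proof.
move=> [Vx h]; apply/SE; split=> // i Ii.
by have /sgn_ofE[] := h i Ii.
Qed.

Let cell_signs x : S x -> cellS (signs x) x.
Proof.
move=> /SE[Vx h]; split=> // j Ij; apply/sgn_ofE; split; first exact: h.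
by rewrite inE Ij.
Qed.

Let signs_cell J x : J \subset I -> cellS J x -> signs x = J.
Proof.
move=> /subsetP JI [_ h]; apply/setP => j; rewrite inE.
case: (boolP (j \in I)) => [Ij|nI]; last first.
  by apply/esym/negbTE; apply: contra nI => /JI.
by have /sgn_ofE[_ ->] := h j Ij.
Qed.

Let line_continuous x v : continuous (fun t : R => x + t *: v).
Proof. by move=> t; apply: cvgD; [exact: cvg_cst|apply: cvgZl; exact: cvg_id]. Qed.

(** On a component each coordinate in [I] runs through an interval without 0, so its sign is
    constant. Conversely, a cell is convex: the segment from [x] to [y] stays in it. *)
Let component_cell x : S x -> connected_component S x = cellS (signs x).
Proof.
move=> Sx; apply/seteqP; split=> y.
  move=> Cy; have /SE[Vy y0] : S y := connected_component_sub Cy.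
  split=> // j Ij; apply/sgn_ofE; split; first exact: y0.
  rewrite inE Ij /=.
  have cj : connected ((fun z : 'rV[R]_n => z ord0 j) @` connected_component S x).
    apply: connected_continuous_connected; first exact: component_connected.
    by apply: continuous_subspaceT => z; apply: coord_continuous.
  have itv := (connected_intervalP _).1 cj.
  have xin : ((fun z : 'rV[R]_n => z ord0 j) @` connected_component S x) (x ord0 j).
    by exists x => //; apply: connected_component_refl.
  have yin : ((fun z : 'rV[R]_n => z ord0 j) @` connected_component S x) (y ord0 j).
    by exists y.
  have n0 : ~ ((fun z : 'rV[R]_n => z ord0 j) @` connected_component S x) 0.
    move=> [z /connected_component_sub /SE[_ /(_ j Ij)] + e].
    by rewrite e eqxx.
  have /SE[_ /(_ j Ij) x0] := Sx; have {}y0 := y0 j Ij.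
  case: (ltrgt0P (x ord0 j)) x0 => // xj _; case: (ltrgt0P (y ord0 j)) y0 => // yj _.
    by case: n0; apply: (itv _ _ yin xin 0); rewrite !ltW.
  by case: n0; apply: (itv _ _ xin yin 0); rewrite !ltW.
move=> Cy; pose f (t : R) := x + t *: (y - x).
have Sx' := cell_signs Sx.
have sub : f @` `[0, 1] `<=` S.
  move=> _ [t /= tI <-]; apply: (@cell_sub (signs x)).
  move: tI; rewrite in_itv /= => /andP[t0 t1].
  have [[Vx hx] [Vy hy]] := (Sx', Cy); split.
    have -> : f t - u = t *: (y - u) + ((1 - t) *: (x - u) + 0).
      by apply/row0P => j; rewrite !mxE; ring.
    by case: Vlin => V0 Vl; apply: (Vl) => //; apply: (Vl).
  move=> j Ij; have -> : sgn_of R (signs x) j * f t ord0 j =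
      (1 - t) * (sgn_of R (signs x) j * x ord0 j) +
        t * (sgn_of R (signs x) j * y ord0 j) by rewrite !mxE; ring.
  have [px py] := (hx j Ij, hy j Ij).
  case: (ltrgt0P t) t0 => // [t0|->] _; last by rewrite subr0 mul1r mul0r addr0.
  apply: ltr_pwDr; first exact: mulr_gt0.
  by apply: mulr_ge0; [rewrite subr_ge0|exact: ltW].
have cf : connected (f @` `[0, 1]).
  apply: connected_continuous_connected; first exact: segment_connected.
  by apply: continuous_subspaceT; apply: line_continuous.
apply: (connected_component_max _ sub cf).
  exists 0; first by rewrite /= in_itv /= lexx ler01.
  by rewrite /f scale0r addr0.
exists 1; first by rewrite /= in_itv /= lexx ler01.
by rewrite /f scale1r addrC subrK.
Qed.

Let recession_cell J x : cellS J x ->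
  recession_cone (cellS J) `&` coord_subspace I = [set v | cone V I J v].
Proof.
move=> Cx; apply/seteqP; split=> v.
  move=> [rec v0]; split=> //.
    have [] := rec x 1 Cx ler01; rewrite scale1r => Vxv _; have [Vx _] := Cx.
    have -> : v = (-1) *: (x - u) + (x + v - u).
      by apply/row0P => j; rewrite !mxE; ring.
    by case: Vlin => _; apply.
  move=> j Ij; rewrite leNgt; apply/negP => vj.
  have [_ /(_ j Ij) xj] := Cx.
  (* The time at which the ray from [x] along [v] would hit the hyperplane of the j-th
     coordinate. *)
  pose t := (sgn_of R J j * x ord0 j) / - (sgn_of R J j * v ord0 j).
  have [] := rec x t Cx; first by rewrite divr_ge0 ?oppr_ge0 // ltW.
  move=> _ /(_ j Ij); rewrite !mxE mulrDr mulrCA /t invrN mulrN mulNr.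
  by rewrite divfK ?lt_eqF // subrr ltxx.
move=> [Vv v0 vpos]; split=> // y t [Vy yh] t0; split.
  rewrite addrAC addrC; case: Vlin => _; apply => //.
by move=> j Ij; rewrite !mxE mulrDr mulrCA ltr_pwDl ?yh // mulr_ge0 // vpos.
Qed.

(** Any point of a cell determines its sign vector, so distinct counted sets [J] give distinct
    regions. *)
Lemma regions_card :
  ([set C | regions (affine_perp L u) I C /\
            recession_cone C `&` coord_subspace I = [set 0]]
   #= `I_(nbcells V u I))%card.
Proof.
pose D := [set J | counted V u I J]%SET.
have -> : [set C | regions (affine_perp L u) I C /\
    recession_cone C `&` coord_subspace I = [set 0]] =
    (fun k : 'I_#|D| => cellS (enum_val k)) @` [set: 'I_#|D|].
  apply/seteqP; split=> C.
    move=> [[x Sx <-]]; rewrite component_cell // => rec.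
    have DJ : signs x \in D.
      rewrite inE; apply/and3P; split.
      - by apply/subsetP => j; rewrite inE => /andP[].
      - by apply/asboolP; exists x; apply: cell_signs.
      apply/asboolP => v cv; suff : [set 0] v by [].
      by rewrite -rec (recession_cell (cell_signs Sx)).
    by exists (enum_rank_in DJ (signs x)) => //; rewrite enum_rankK_in.
  move=> [k _ <-]; have := enum_valP k; rewrite inE.
  move: (enum_val k) => J /and3P[JI /asboolP[x Cx] /asboolP triv]; split.
    have Sx := cell_sub Cx; exists x => //.
    by rewrite component_cell // (signs_cell JI Cx).
  rewrite (recession_cell Cx); apply/seteqP; split=> v; first exact: triv.
  move=> ->; split=> [|j _|j _]; rewrite ?mxE ?mulr0 //.
  by case: Vlin.
apply: card_eq_trans (card_esym card_II); apply: inj_card_eq => k l _ _ e.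
apply: enum_val_inj; have := enum_valP k; have := enum_valP l; rewrite !inE.
move=> /and3P[lI _ _] /and3P[kI /asboolP[x Cx] _].
rewrite -(signs_cell kI Cx); apply: signs_cell => //.
by have <- : cellS (enum_val k) = cellS (enum_val l) := e.
Qed.

End RegionsAreCells.

(** * Independence of the standard monomials *)

Section RegularAtZero.
Variable K : numFieldType.
Implicit Types (f g : K -> K) (u v : K) (p : {poly K}).

Lemma poly_vanish p : (forall t, p.[t] = 0) -> p = 0.
Proof.
move=> h; apply/eqP; apply: contraT => p0.
pose s := [seq k%:R : K | k <- iota 0 (size p)].
have su : uniq s.
  by rewrite map_inj_uniq ?iota_uniq // => k l /eqP; rewrite eqr_nat => /eqP.
have := max_poly_roots p0 _ su; rewrite size_map size_iota ltnn; apply.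
by apply/allP => t _; apply/rootP.
Qed.

(* f agrees near 0 with a rational function without pole at 0, whose value
   there is v: an algebraic substitute for "f t tends to v as t tends to 0" *)
Definition regular_at0 f v := exists a b : {poly K},
  [/\ b.[0] != 0, a.[0] = v * b.[0] & forall t, b.[t] != 0 -> f t * b.[t] = a.[t]].

Lemma regular_poly p : regular_at0 (horner p) p.[0].
Proof.
exists p, 1; split=> [||t _]; first by rewrite hornerC oner_eq0.
  by rewrite hornerC mulr1.
by rewrite hornerC mulr1.
Qed.

Lemma regular_eq f g v : f =1 g -> regular_at0 f v -> regular_at0 g v.
Proof.
by move=> fg [a [b [b0 a0 h]]]; exists a, b; split=> // t; rewrite -fg; apply: h.
Qed.

Lemma regular_cst v : regular_at0 (fun=> v) v.
Proof.
have := regular_poly v%:P; rewrite hornerC; apply: regular_eq => t.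
by rewrite hornerC.
Qed.

Lemma regularD f g u v :
  regular_at0 f u -> regular_at0 g v -> regular_at0 (fun t => f t + g t) (u + v).
Proof.
move=> [a [b [b0 a0 hf]]] [c [d [d0 c0 hg]]].
exists (a * d + c * b), (b * d); rewrite hornerD !hornerM mulf_neq0 //.
split=> // [|t].
  by rewrite a0 c0; ring.
rewrite ?hornerD !hornerM mulf_eq0 negb_or => /andP[bt dt].
by rewrite -hf // -hg //; ring.
Qed.

Lemma regularM f g u v :
  regular_at0 f u -> regular_at0 g v -> regular_at0 (fun t => f t * g t) (u * v).
Proof.
move=> [a [b [b0 a0 hf]]] [c [d [d0 c0 hg]]].
exists (a * c), (b * d); rewrite !hornerM mulf_neq0 //; split=> // [|t].
  by rewrite a0 c0; ring.
rewrite ?hornerD !hornerM mulf_eq0 negb_or => /andP[bt dt].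
by rewrite -hf // -hg //; ring.
Qed.

Lemma regularV f u :
  u != 0 -> regular_at0 f u -> regular_at0 (fun t => (f t)^-1) u^-1.
Proof.
move=> u0 [a [b [b0 a0 hf]]].
exists (b * b), (a * b); rewrite !hornerM a0 !mulf_neq0 //; split=> // [|t].
  by field.
rewrite ?hornerD !hornerM mulf_eq0 negb_or => /andP[at0 bt].
have ft : f t != 0 by apply: contraNneq at0 => ft; rewrite -hf // ft mul0r.
by rewrite -hf //; field.
Qed.

Lemma regularX f u k : regular_at0 f u -> regular_at0 (fun t => f t ^+ k) (u ^+ k).
Proof.
move=> hf; elim: k => [|k IH]; first exact: regular_cst.
by rewrite exprS; apply: regular_eq (regularM hf IH) => t; rewrite exprS.
Qed.

Lemma regular_sum (J : Type) (s : seq J) (F : J -> K -> K) (V : J -> K) :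
  (forall j, regular_at0 (F j) (V j)) ->
  regular_at0 (fun t => \sum_(j <- s) F j t) (\sum_(j <- s) V j).
Proof.
move=> h; elim: s => [|j s IH].
  by rewrite big_nil; apply: regular_eq (regular_cst 0) => t; rewrite big_nil.
by rewrite big_cons; apply: regular_eq (regularD (h j) IH) => t; rewrite big_cons.
Qed.

Lemma regular_prod (J : Type) (s : seq J) (F : J -> K -> K) (V : J -> K) :
  (forall j, regular_at0 (F j) (V j)) ->
  regular_at0 (fun t => \prod_(j <- s) F j t) (\prod_(j <- s) V j).
Proof.
move=> h; elim: s => [|j s IH].
  by rewrite big_nil; apply: regular_eq (regular_cst 1) => t; rewrite big_nil.
by rewrite big_cons; apply: regular_eq (regularM (h j) IH) => t; rewrite big_cons.
Qed.

(** The factor [p] removes the finitely many [t] where nothing is known about [f]. Then [a * b * p]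
    vanishes everywhere, which forces [a] to be 0. *)
Lemma regular_eq0 f v p : p != 0 -> (forall t, p.[t] != 0 -> f t = 0) ->
  regular_at0 f v -> v = 0.
Proof.
move=> p0 hp [a [b [b0 a0 h]]].
have /eqP : a * b * p = 0.
  apply: poly_vanish => t; rewrite !hornerM.
  have [->|bt] := eqVneq b.[t] 0; first by rewrite mulr0 mul0r.
  have [->|pt] := eqVneq p.[t] 0; first by rewrite mulr0.
  by rewrite -h // hp // !mul0r.
have b_neq0 : b != 0 by apply: contraNneq b0 => ->; rewrite horner0.
rewrite !mulf_eq0 (negPf p0) (negPf b_neq0) !orbF => /eqP a_eq0.
move/eqP: a0; rewrite a_eq0 horner0 eq_sym mulf_eq0 (negPf b0) orbF.
by move/eqP.
Qed.

End RegularAtZero.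

(** * Polynomials cut by the power of one variable *)

Section Slices.
Variables (K : numFieldType) (n : nat).
Implicit Types (p q : mpoly n K) (m : multinom n) (i j : 'I_n) (u v : 'I_n -> K).

Definition mnm_supp m : {set 'I_n} := [set j | m j != 0%N].

Definition mnm_reset i m : multinom n :=
  Multinom [tuple if j == i then 0%N else m j | j < n].

Lemma mnm_resetE i m j : mnm_reset i m j = if j == i then 0%N else m j.
Proof. by rewrite mnmE. Qed.

Lemma mnm_reset_id i m : m i = 0%N -> mnm_reset i m = m.
Proof.
by move=> mi; apply/mnmP => j; rewrite mnm_resetE; case: eqP => // ->.
Qed.

Lemma mnm_supp_reset i m : mnm_supp (mnm_reset i m) = mnm_supp m :\ i.
Proof.
by apply/setP => j; rewrite !inE mnm_resetE; case: (j == i).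
Qed.

Lemma meval_eq_on u v p :
  (forall m j, m \in msupp p -> j \in mnm_supp m -> u j = v j) ->
  meval u p = meval v p.
Proof.
move=> h; rewrite !mevalE big_seq [RHS]big_seq; apply: eq_bigr => m mp.
congr (_ * _); apply: eq_bigr => j _.
have [mj|mj] := eqVneq (m j) 0%N; first by rewrite mj !expr0.
by rewrite (h m) // inE.
Qed.

(* The coefficient of the k-th power of the variable i. *)
Definition slice i k p : mpoly n K :=
  \sum_(m <- msupp p | m i == k) mcoeff m p *: mpolyX K (mnm_reset i m).

Lemma mcoeff_slice i p m : mcoeff (mnm_reset i m) (slice i (m i) p) = mcoeff m p.
Proof.
rewrite /slice raddf_sum /= (eq_bigr (fun m' => mcoeff m' p * (m' == m)%:R)).
  have [mp|mp] := boolP (m \in msupp p).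
    rewrite big_mkcond (bigD1_seq m) ?msupp_uniq //= !eqxx mulr1 big1 ?addr0 //.
    by move=> m' /negPf ->; rewrite mulr0 if_same.
  rewrite big_seq_cond big1; first by apply/esym/eqP; rewrite mcoeff_eq0.
  move=> m' /andP[m'p _]; case: eqP => [e|]; last by rewrite mulr0.
  by rewrite -e m'p in mp.
move=> m' /eqP m'i; rewrite mcoeffZ mcoeffX; congr (_ * _%:R); congr (nat_of_bool _).
apply/eqP/eqP => [/mnmP e|->//]; apply/mnmP => j.
by have := e j; rewrite !mnm_resetE; case: eqP => [->|].
Qed.

Lemma slice_supp i k p m : m \in msupp (slice i k p) ->
  exists m', [/\ m' \in msupp p, m' i = k & m = mnm_reset i m'].
Proof.
move=> /msupp_sum_le /flattenP[s /mapP[m']]; rewrite mem_filter => /andP[/eqP m'k m'p].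
by move=> -> /msuppZ_le; rewrite msuppX mem_seq1 => /eqP ->; exists m'.
Qed.

Lemma slice0_id i p : (forall m, m \in msupp p -> m i = 0%N) -> slice i 0 p = p.
Proof.
move=> h; rewrite [RHS]mpolyE /slice big_seq_cond [RHS]big_seq.
apply: eq_big => [m|m /andP[mp _]]; last by rewrite mnm_reset_id ?h.
by apply: andb_idr => /h ->.
Qed.

(** Descending induction on a bound for the exponents of the variable [i]: a zero top slice lowers
    the bound by one. *)
Lemma slice_elim i p :
  (forall k, (forall m, m \in msupp p -> (m i <= k.+1)%N) -> slice i k.+1 p = 0) ->
  forall m, m \in msupp p -> m i = 0%N.
Proof.
move=> h; suff descend k : (forall m, m \in msupp p -> (m i <= k)%N) ->
    forall m, m \in msupp p -> m i = 0%N.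
  by apply: (descend (\max_(m <- msupp p) m i)) => m mp; apply: leq_bigmax_seq.
elim: k => [hk m /hk|k IH hk]; first by rewrite leqn0 => /eqP.
apply: IH => m mp; have := hk m mp; rewrite leq_eqVlt => /orP[/eqP mi|//].
have := mp; rewrite mcoeff_msupp -(mcoeff_slice i) mi h //.
by rewrite mcoeff0 eqxx.
Qed.

(* As t tends to 0, p divided by the k-th power of its i-th variable tends to
   its top slice. *)
Lemma slice_top (f : 'I_n -> K -> K) v (c : {poly K}) i k p :
  (forall j, j != i -> regular_at0 (f j) (v j)) ->
  (forall t, t != 0 -> f i t = t^-1) ->
  (forall m, m \in msupp p -> (m i <= k)%N) ->
  c != 0 -> (forall t, c.[t] != 0 -> meval (f^~ t) p = 0) ->
  meval v (slice i k p) = 0.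
Proof.
move=> fv fi mk c0 hc.
(* [F m t] is t^k times the term of [m] in [p], written without negative powers. At t = 0 only the
   terms with exponent exactly [k] survive. *)
pose F m t := mcoeff m p *
  \prod_j (if j == i then t ^+ (k - m i) else f j t ^+ m j).
pose V m := mcoeff m p *
  \prod_j (if j == i then 0 ^+ (k - m i) else v j ^+ m j).
have FV : regular_at0 (fun t => \sum_(m <- msupp p) F m t) (\sum_(m <- msupp p) V m).
  apply: regular_sum => m; apply: regularM; first exact: regular_cst.
  apply: regular_prod => j; case: eqP => [_|/eqP ji]; last exact/regularX/fv.
  have := @regular_poly K 'X^(k - m i); rewrite hornerXn.
  by apply: regular_eq => t; rewrite hornerXn.
have : \sum_(m <- msupp p) V m = 0.
  (* The factor ['X] excludes t = 0, where [f i] need not be the inverse of [t]. *)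
  apply: (@regular_eq0 _ _ _ (c * 'X)) FV; first by rewrite mulf_neq0 ?polyX_eq0.
  move=> t; rewrite hornerM hornerX mulf_eq0 negb_or => /andP[/hc ct t0].
  transitivity (t ^+ k * meval (f^~ t) p); last by rewrite ct mulr0.
  rewrite mevalE mulr_sumr big_seq [RHS]big_seq.
  apply: eq_bigr => m mp; rewrite /F [RHS]mulrCA; congr (_ * _).
  rewrite (bigD1 i) //= eqxx [in RHS](bigD1 i) //= mulrA fi //; congr (_ * _).
    by rewrite exprVn expfB_cond // (negPf t0) add0n mk.
  by apply: eq_bigr => j /negPf ->.
move=> V0; transitivity (\sum_(m <- msupp p) V m); last exact: V0.
rewrite /slice raddf_sum /= big_mkcond big_seq [RHS]big_seq.
apply: eq_bigr => m mp; rewrite /V.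
rewrite [in RHS](bigD1 i) //= eqxx.
case: eqP => [->|/eqP mi].
  rewrite subnn expr0 mul1r mevalZ mevalX; congr (_ * _).
  rewrite (bigD1 i) //= mnm_resetE eqxx expr0 mul1r.
  by apply: eq_bigr => j ji; rewrite mnm_resetE (negPf ji).
have : (0 < k - m i)%N by rewrite subn_gt0 ltn_neqAle mi mk.
by case: (k - m i)%N => // l _; rewrite expr0n mul0r mulr0.
Qed.

(** Induction on the set of variables: giving one of them the value 1/t and fixing the others,
    [slice_top] shows that every top slice vanishes at all points. *)
Lemma meval_eq0 p : (forall v, meval v p = 0) -> p = 0.
Proof.
suff h (S : {set 'I_n}) : (forall m, m \in msupp p -> mnm_supp m \subset S) ->
    (forall v, meval v p = 0) -> p = 0.
  by apply: (h setT) => m _; apply: subsetT.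
move: {2}#|S| (erefl #|S|) => r; elim: r => [|r IH] in S p *.
  move=> /cards0_eq -> mS p0.
  have p1 : (msize p <= 1)%N.
    rewrite msizeE; apply/bigmax_leqP_seq => m /mS; rewrite subset0 => /eqP m0 _.
    rewrite ltnS leqn0 mdegE big1 // => j _; apply/eqP; apply: contraT => mj.
    by have : j \in mnm_supp m by [rewrite inE]; rewrite m0 inE.
  by have := p0 (fun=> 0); rewrite (msize1_polyC p1) mevalC => ->; rewrite mpolyC0.
move=> cS mS p0; have [i Si] : exists i, i \in S by apply/set0Pn; rewrite -card_gt0 cS.
have cS' : #|S :\ i| = r by move: cS; rewrite (cardsD1 i) Si => -[].
have mi : forall m, m \in msupp p -> m i = 0%N.
  apply: slice_elim => k mk; apply: (IH _ _ cS') => [m|v].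
    by move=> /slice_supp[m' [/mS sub _ ->]]; rewrite mnm_supp_reset setSD.
  apply: (@slice_top (fun j t => if j == i then t^-1 else v j) v 1) => //.
    by move=> j /negPf ->; apply: regular_cst.
    by move=> t _; rewrite eqxx.
    exact: oner_neq0.
apply: (IH _ _ cS') => // m mp; rewrite subsetD1 mS //.
by rewrite inE mi.
Qed.

End Slices.

(** * Standard monomials on the inverted space *)

Section StandardMonomials.
Variables (R : realType) (n : nat) (w : 'rV[R]_n).
Hypothesis w_inj : injective (w ord0).
Local Notation K := R[i].
Implicit Types (L : {vspace 'rV[K]_n}) (I : {set 'I_n}) (i j : 'I_n).
Implicit Types (p q : mpoly n K) (x y e : 'rV[K]_n) (m : multinom n).

Local Notation Delta L I := (semi_broken_complex w (circuits L) I).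

Definition vanishes_on_inv L I p := forall x, x \in L ->
  (forall i, i \in I -> x ord0 i != 0) -> peval p (inv_coord I x) = 0.

Lemma vanishes_on_invP L I p :
  vanishes_on (inv_space L I) p <-> vanishes_on_inv L I p.
Proof.
split=> [h x Lx x0|h x]; last first.
  by move=> /(_ p); apply=> _ [y [Ly y0] <-]; apply: h.
by apply: h => q; apply; exists x.
Qed.

(** Apply [slice_top] along [y + t *: e]. If y_i = 0, its inverted i-th coordinate is 1/t; this
    serves the contraction. If k = 0, the variable [i] does not occur in [p], so its value is free;
    this serves the deletion. *)
Lemma slice_vanishes L I i k p e y : vanishes_on_inv L I p ->
    e \in L -> e ord0 i = 1 -> y \in L ->
    (forall j, j \in I :\ i -> y ord0 j != 0) -> i \in I ->
    (forall m, m \in msupp p -> (m i <= k)%N) -> y ord0 i = 0 \/ k = 0%N ->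
  peval (slice i k p) (inv_coord (I :\ i) y) = 0.
Proof.
move=> pI Le ei Ly y0 Ii mk yk.
pose f j t : K := inv_coord I (y + t *: e) ord0 j.
(* Where [c] is nonzero, all coordinates of [y + t *: e] in [I] are nonzero. It is not the zero
   polynomial, because e_i = 1 and the other y_j are nonzero. *)
pose c := \prod_(j in I) ((y ord0 j)%:P + e ord0 j *: 'X).
have cE j t : ((y ord0 j)%:P + e ord0 j *: 'X).[t] = (y + t *: e) ord0 j.
  by rewrite !hornerE !mxE mulrC.
apply: (@slice_top _ _ (fun j t => if j == i then t^-1 else f j t) _ c) => //.
- move=> j ji; rewrite (negPf ji) /f.
  have rj := regular_poly ((y ord0 j)%:P + e ord0 j *: 'X).
  have {}rj : regular_at0 (fun t => (y + t *: e) ord0 j) (y ord0 j).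
    have e0 : (y + 0 *: e) ord0 j = y ord0 j by rewrite scale0r addr0.
    by rewrite -e0 -cE; apply: regular_eq rj => t; rewrite cE.
  rewrite /inv_coord mxE in_setD1 ji /=; case: ifP => Ij.
    have yj : y ord0 j != 0 by apply: y0; rewrite in_setD1 ji.
    by apply: regular_eq (regularV yj rj) => t; rewrite [in RHS]mxE Ij.
  by apply: regular_eq rj => t; rewrite [in RHS]mxE Ij.
- by move=> t _; rewrite eqxx.
- apply/prodf_neq0 => j Ij; case: (eqVneq j i) => [->|ji].
    apply/negP => /eqP/(congr1 (fun q : {poly K} => q`_1)).
    by rewrite coefD coefC coefZ coefX ei mulr1 add0r coef0 => /eqP; rewrite oner_eq0.
  apply/negP => /eqP/(congr1 (horner^~ 0)); rewrite cE scale0r addr0 horner0.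
  by apply/eqP/y0; rewrite in_setD1 ji.
move=> t; rewrite horner_prod => /prodf_neq0 ct.
have yt j : j \in I -> (y + t *: e) ord0 j != 0 by move/ct; rewrite cE.
have Lyt : y + t *: e \in L by rewrite rpredD // memvZ.
rewrite -[RHS](pI _ Lyt yt); apply: meval_eq_on => m j mp mj.
case: eqP => // ji; case: yk => [yi|k0].
  by rewrite ji /f mxE Ii !mxE yi ei mulr1 add0r.
by have := mk m mp; rewrite k0 leqn0 -ji; move: mj; rewrite inE => /negPf ->.
Qed.

Lemma standard_independent I L p :
  (forall m, m \in msupp p -> mnm_supp m \in Delta L I) ->
  vanishes_on_inv L I p -> p = 0.
Proof.
move: {2}#|I| (erefl #|I|) => r; elim: r => [|r IH] in I L p *.
  move=> /cards0_eq -> mD pI; apply: meval_eq0 => v.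
  (* All monomials of [p] live on [nonleading L], where points of [L] take arbitrary values. *)
  have [x Lx xv] := nonleading_onto w L (\row_j v j).
  have x0 i : i \in set0 -> x ord0 i != 0 by rewrite inE.
  rewrite -(pI x Lx x0); apply: meval_eq_on => m j /mD.
  rewrite complex_set0E // => /subsetP sub /sub jB.
  by rewrite mxE inE xv // mxE.
move=> cI mD pI.
have [k0 Ik0] : exists k, k \in I by apply/set0Pn; rewrite -card_gt0 cI.
have [i /wmaxP[Ii imax]] := wmax_neq0 w Ik0.
have cI' : #|I :\ i| = r by move: cI; rewrite (cardsD1 i) Ii => -[].
have [iL|iL] := pselect (is_loop L i).
  apply: msuppnil0; case: (msupp p) mD => // m s /(_ m (mem_head _ _)).
  by rewrite (complex_loop w Ii iL) inE.
have [e Le ei] := nonloop_witness iL.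
have p0 m : m \in msupp p -> m i = 0%N.
  move: m; apply: slice_elim => k mk; apply: (IH _ (contraction L i) _ cI').
    move=> m /slice_supp[m' [/mD m'D m'i ->]]; rewrite mnm_supp_reset.
    have im' : i \in mnm_supp m' by rewrite inE m'i.
    rewrite -(complex_contraction w_inj Ii imax iL) ?setD1K //.
    by rewrite !inE eqxx.
  move=> y; rewrite mem_contraction => /andP[Ly /eqP yi] y0.
  by apply: (slice_vanishes pI Le ei Ly y0 Ii mk); left.
apply: (IH _ (deletion L i) _ cI') => [m mp|x].
  rewrite -(complex_deletion w_inj Ii imax iL) ?mD //.
  by rewrite inE p0.
move=> /mem_deletion[y Ly ->] y0.
have y0' j : j \in I :\ i -> y ord0 j != 0.
  by move=> Ij; have := y0 j Ij; move: Ij; rewrite in_setD1 maskE !inE => /andP[-> _].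
have p_le0 m : m \in msupp p -> (m i <= 0)%N by move=> mp; rewrite p0.
have := slice_vanishes pI Le ei Ly y0' Ii p_le0 (or_intror erefl).
rewrite (slice0_id p0) => h; apply: etrans h.
apply: meval_eq_on => m j mp mj.
have ji : j != i by apply: contraTneq mj => ->; rewrite inE p0.
by rewrite [LHS]mxE [RHS]mxE maskE in_setC1 ji.
Qed.

End StandardMonomials.

(** * Reduction to standard monomials *)

Section Reduction.
Variables (R : realType) (n : nat) (w : 'rV[R]_n).
Hypotheses (w_gt0 : forall i, 0 < w ord0 i) (w_inj : injective (w ord0)).
Local Notation K := R[i].
Variables (L : {vspace 'rV[K]_n}) (I : {set 'I_n}).
Implicit Types (S A : {set 'I_n}) (i j : 'I_n) (s : nat).
Implicit Types (p q : mpoly n K) (a x : 'rV[K]_n) (m : multinom n).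

Local Notation Delta := (semi_broken_complex w (circuits L) I).

Definition mnm_set A : multinom n := Multinom [tuple nat_of_bool (j \in A) | j < n].

Lemma mnm_setE A j : mnm_set A j = (j \in A).
Proof. by rewrite mnmE. Qed.

Definition mnm_weight m : R := \sum_j (w ord0 j) *+ m j.

Lemma mnm_weightD m1 m2 :
  mnm_weight (mnm_add m1 m2) = mnm_weight m1 + mnm_weight m2.
Proof.
by rewrite -big_split; apply: eq_bigr => j _; rewrite mnmDE mulrnDr.
Qed.

Lemma mnm_weight_set A : mnm_weight (mnm_set A) = \sum_(j in A) w ord0 j.
Proof.
rewrite [RHS]big_mkcond; apply: eq_bigr => j _.
by rewrite mnm_setE; case: (j \in A); rewrite ?mulr1n ?mulr0n.
Qed.

Lemma mdeg_set A : mdeg (mnm_set A) = #|A|.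
Proof.
rewrite mdegE -sum1_card [RHS]big_mkcond; apply: eq_bigr => j _.
by rewrite mnm_setE; case: (j \in A).
Qed.

(* The exponents of the monomials of
   x^(S & I) (\sum_(j in S & I) a_j / x_j + \sum_(j in S \ I) a_j x_j). *)
Definition term_support S j := if j \in I then (S :&: I) :\ j else j |: (S :&: I).

Definition circuit_poly a : mpoly n K :=
  \sum_(j in supp a) a ord0 j *: mpolyX K (mnm_set (term_support (supp a) j)).

(** At the inverted point the polynomial equals [dot a x] times the product of the inverses of x_j
    over [supp a :&: I]. *)
Lemma circuit_poly_vanishes a : perp L a -> vanishes_on_inv L I (circuit_poly a).
Proof.
move=> aL x Lx x0; rewrite /peval /circuit_poly raddf_sum /=.
pose P := \prod_(j in supp a :&: I) (x ord0 j)^-1.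
have evalE A : meval (fun j => inv_coord I x ord0 j) (mpolyX K (mnm_set A)) =
    \prod_(j in A) inv_coord I x ord0 j.
  rewrite mevalX [RHS]big_mkcond; apply: eq_bigr => j _.
  by rewrite mnm_setE; case: (j \in A); rewrite ?expr1 ?expr0.
have PE : \prod_(j in supp a :&: I) inv_coord I x ord0 j = P.
  by apply: eq_bigr => j; rewrite in_setI mxE => /andP[_ ->].
transitivity (\sum_j P * (a ord0 j * x ord0 j)); last first.
  by rewrite -mulr_sumr (aL x Lx) mulr0.
rewrite big_mkcond; apply: eq_bigr => j _; case: ifP => [aj|]; last first.
  by rewrite inE => /negbFE/eqP ->; rewrite mul0r mulr0.
rewrite mevalZ evalE mulrCA; congr (_ * _); rewrite /term_support.
case: (boolP (j \in I)) => Ij; last first.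
  by rewrite big_setU1 ?in_setI ?(negPf Ij) ?andbF //= PE mxE (negPf Ij) mulrC.
have jSI : j \in supp a :&: I by rewrite in_setI aj.
rewrite -PE (big_setD1 j jSI) /=.
by rewrite mxE Ij mulrAC mulVf ?x0 // mul1r.
Qed.

(** Compared with x^(S & I), the term of [j] loses w_j if [j] is in [I] and gains w_j otherwise. As
    weights are positive, the heaviest term belongs to the maximum of [S :\: I], or to the minimum
    of [S] when [S] lies in [I]: the choices made by [semi_broken]. *)
Lemma leading_term S : S != set0 -> exists j0, [/\ j0 \in S,
    term_support S j0 = semi_broken w I S &
    forall j, j \in S -> j != j0 ->
      (#|term_support S j| <= #|term_support S j0|)%N /\
      mnm_weight (mnm_set (term_support S j)) <
      mnm_weight (mnm_set (term_support S j0))].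
Proof.
move=> S0; pose W := \sum_(j in S :&: I) w ord0 j.
have inW j : j \in S -> j \in I ->
    mnm_weight (mnm_set (term_support S j)) = W - w ord0 j.
  move=> Sj Ij; rewrite mnm_weight_set /W (big_setD1 j (A := S :&: I)) ?in_setI ?Sj //=.
  by rewrite /term_support Ij addrAC subrr add0r.
have outW j : j \notin I -> mnm_weight (mnm_set (term_support S j)) = W + w ord0 j.
  move=> Ij; rewrite mnm_weight_set /term_support (negPf Ij).
  by rewrite addrC /W big_setU1 // in_setI (negPf Ij) andbF.
have inC j : j \in S -> j \in I -> #|term_support S j|.+1 = #|S :&: I|.
  by move=> Sj Ij; rewrite /term_support Ij [RHS](cardsD1 j) in_setI Sj Ij.
have outC j : j \notin I -> #|term_support S j| = #|S :&: I|.+1.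
  by move=> Ij; rewrite /term_support (negPf Ij) cardsU1 in_setI (negPf Ij) andbF.
have [SI|SI] := boolP (S \subset I).
  have [k0 Sk0] := set0Pn _ S0.
  case: (arg_minP (fun k => w ord0 k) Sk0) => j0 Sj0 jmin.
  have {}Sj0 : j0 \in S := Sj0.
  have Ij := subsetP SI.
  exists j0; split=> // [|j Sj jj0].
    rewrite /term_support Ij // /semi_broken SI (setIidPl SI); congr (_ :\: _).
    apply/setP => j; rewrite !inE; apply/eqP/andP => [->|[Sj /forall_inP h]].
      by split=> //; apply/forall_inP => k /jmin.
    by apply: w_inj; apply: le_anti; rewrite h // jmin.
  split; first by rewrite -ltnS !inC ?Ij.
  rewrite !inW ?Ij // ltrD2l ltrN2 lt_neqAle jmin // andbT.
  by apply: contra jj0 => /eqP/w_inj ->.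
have [k0 Sk0] : exists j, j \in S :\: I.
  by have /subsetPn [j Sj jI] := SI; exists j; rewrite in_setD Sj jI.
have [j0 jmax] := wmax_neq0 w Sk0.
have /wmaxP[/setDP[Sj0 jI0] jle] := jmax.
exists j0; split=> // [|j Sj jj0].
  rewrite /term_support (negPf jI0) /semi_broken (negPf SI) setUC; congr (_ :|: _).
  apply/setP => j; rewrite in_set1; apply/eqP/idP => [->//|/wmaxP[Sj jle']].
  apply: w_inj; apply: le_anti; rewrite jle // jle' //.
  by rewrite in_setD jI0.
have [Ij|Ij] := boolP (j \in I).
  split; first by rewrite -ltnS inC // outC // ltnW.
  by rewrite inW // outW // ltrD2l (lt_trans _ (w_gt0 j0)) // oppr_lt0.
rewrite !outC // !outW // leqnn ltrD2l lt_neqAle jle ?in_setD ?Ij // andbT.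
by split=> //; apply: contra jj0 => /eqP/w_inj ->.
Qed.

Definition standard s q :=
  forall m, m \in msupp q -> (mdeg m <= s)%N /\ mnm_supp m \in Delta.

Definition reducible s p :=
  exists2 q, standard s q & vanishes_on_inv L I (p - q).

Lemma reducible_standard s q : standard s q -> reducible s q.
Proof. by move=> qs; exists q => // x _ _; rewrite subrr /peval meval0. Qed.

Lemma standard0 s : standard s 0.
Proof. by move=> m; rewrite mcoeff_msupp mcoeff0 eqxx. Qed.

Lemma reducible_vanishing s p : vanishes_on_inv L I p -> reducible s p.
Proof. by move=> pI; exists 0; [exact: standard0|rewrite subr0]. Qed.

Lemma reducibleD s p q : reducible s p -> reducible s q -> reducible s (p + q).
Proof.
move=> [p' ps pp'] [q' qs qq']; exists (p' + q').
  by move=> m /msuppD_le; rewrite mem_cat => /orP[/ps|/qs].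
move=> x Lx x0; rewrite opprD addrACA /peval mevalD.
by rewrite -!/(peval _ _) pp' // qq' // addr0.
Qed.

Lemma reducibleZ s c p : reducible s p -> reducible s (c *: p).
Proof.
move=> [p' ps pp']; exists (c *: p'); first by move=> m /msuppZ_le /ps.
move=> x Lx x0; rewrite -scalerBr /peval mevalZ.
by rewrite -/(peval _ _) pp' // mulr0.
Qed.

Lemma reducible_sum s (J : Type) (r : seq J) (P : pred J) (F : J -> mpoly n K) :
  (forall k, P k -> reducible s (F k)) -> reducible s (\sum_(k <- r | P k) F k).
Proof.
move=> h; apply: (big_ind (reducible s)) => //.
  exact/reducible_standard/standard0.
exact: reducibleD.
Qed.

Lemma reducible_monomial s m : (mdeg m <= s)%N -> reducible s (mpolyX K m).
Proof.
(* Weights are real numbers, so the descent is measured by the finite number of lighter monomials of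
   degree at most [s]. *)
pose rank m := #|[set m' : bmultinom n s.+1 | mnm_weight m' < mnm_weight m]|.
move: {2}(rank m).+1 (ltnSn (rank m)) => r; elim: r => // r IH in m *.
rewrite ltnS => mr ms; have [mD|] := boolP (mnm_supp m \in Delta).
  by apply: reducible_standard => m'; rewrite msuppX mem_seq1 => /eqP ->.
move=> /notin_complexP[a [aL a0 sub]].
have S0 : supp a != set0 by rewrite supp_eq0.
have [j0 [Sj0 e0 lead]] := leading_term S0.
have aj0 : a ord0 j0 != 0 by move: Sj0; rewrite inE.
pose g j := mnm_set (term_support (supp a) j).
pose m' := mnm_sub m (g j0).
have mE : m = mnm_add m' (g j0).
  apply/esym/submK/mnm_lepP => j; rewrite mnm_setE e0.
  case: (boolP (j \in _)) => // /(subsetP sub); rewrite inE.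
  by rewrite lt0n.
(* The relation of [a], multiplied by the cofactor [m'] of its leading term in [m], trades x^m for
   lighter monomials. *)
have eX : mpolyX K m = (a ord0 j0)^-1 *: (circuit_poly a * mpolyX K m') +
    \sum_(j in supp a | j != j0)
      (- (a ord0 j0)^-1 * a ord0 j) *: mpolyX K (mnm_add m' (g j)).
  rewrite {1}/circuit_poly (bigD1 j0) //= mulrDl scalerDr -scalerAl scalerA.
  rewrite mulVf // scale1r -mpolyXD addmC -mE -[LHS]addr0 -addrA; congr (_ + _).
  rewrite mulr_suml scaler_sumr -big_split big1 //= => j _.
  by rewrite -scalerAl scalerA -mpolyXD addmC mulNr scaleNr subrr.
rewrite eX; apply: reducibleD.
  apply: reducible_vanishing => x Lx x0; rewrite /peval mevalZ mevalM.
  have := circuit_poly_vanishes aL Lx x0; rewrite /peval => ->.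
  by rewrite mul0r mulr0.
apply: reducible_sum => j /andP[Sj jj0]; apply: reducibleZ.
have [dj wj] := lead j Sj jj0.
have ms1 : (mdeg (mnm_add m' (g j)) <= s)%N.
  by apply: leq_trans ms; rewrite [X in (_ <= mdeg X)%N]mE !mdegD !mdeg_set leq_add2l.
have w1 : mnm_weight (mnm_add m' (g j)) < mnm_weight m.
  by rewrite [X in _ < mnm_weight X]mE !mnm_weightD ltrD2l.
apply: (IH) (ms1); apply: leq_trans mr; apply: proper_card; apply/properP.
split; first by apply/subsetP => m2; rewrite !inE => /lt_trans; apply.
have ms2 : (mdeg (mnm_add m' (g j)) < s.+1)%N by [].
(* The new monomial is lighter than [m] but not lighter than itself, so the rank strictly drops. *)
by exists (BMultinom ms2); rewrite !inE //= ltxx.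
Qed.

Lemma reducible_mpoly s p : (msize p <= s.+1)%N -> reducible s p.
Proof.
move=> ps; rewrite [p]mpolyE big_seq; apply: reducible_sum => m mp.
apply/reducibleZ/reducible_monomial; rewrite -ltnS.
exact: leq_trans (msize_mdeg_lt mp) ps.
Qed.

End Reduction.

(** * The Hilbert polynomial *)

Section CountingMonomials.
Variable n : nat.
Implicit Types (A : {set 'I_n}) (s : nat) (m : multinom n).

Definition nbmonomials A s := #|[set m : bmultinom n s.+1 | mnm_supp m == A]|.

Lemma mnm_supp0 m : (mnm_supp m == set0) = (m == mnm0).
Proof.
apply/eqP/eqP => [/setP e|->]; last by apply/setP => j; rewrite !inE mnm0E.
by apply/mnmP => j; have := e j; rewrite !inE mnm0E => /negbFE/eqP.
Qed.

Lemma mnm_suppD1 m j : mnm_supp (mnm_add m (mnm1 j)) = j |: mnm_supp m.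
Proof.
by apply/setP => k; rewrite !inE mnmDE mnm1E addn_eq0 negb_and eqb0 negbK orbC eq_sym.
Qed.

Lemma nbmonomials0 s : nbmonomials set0 s = 1%N.
Proof.
have m0 : (mdeg (@mnm0 n) < s.+1)%N by rewrite mdeg0.
rewrite -(cards1 (BMultinom m0)); apply: eq_card => m.
by rewrite !inE mnm_supp0 bmeqP.
Qed.

(** Pascal's rule: dividing by x_j leaves a monomial whose support is [A] or [A :\ j], and this is a
    bijection. *)
Lemma nbmonomialsS A s j : j \in A ->
  nbmonomials A s.+1 = (nbmonomials A s + nbmonomials (A :\ j) s)%N.
Proof.
move=> Aj; have mS (m : bmultinom n s.+1) : (mdeg (mnm_add m (mnm1 j)) < s.+2)%N.
  by rewrite mdegD mdeg1 addn1 ltnS; case: m.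
pose h (m : bmultinom n s.+1) := BMultinom (mS m).
have h_inj : injective h.
  move=> m m' /(congr1 (@bmnm _ _)) e.
  by apply: val_inj; apply: (addIm e).
rewrite /nbmonomials -cardsUI.
rewrite [X in _ = (_ + #|pred_of_set X|)%N](_ : _ = set0); last first.
  apply/setP => m; rewrite !inE.
  by case: eqP => //= ->; apply/negbTE/eqP => /setP/(_ j); rewrite !inE Aj eqxx.
rewrite cards0 addn0 -[RHS](card_imset _ h_inj); apply: eq_card => m.
apply/idP/imsetP => [|[m']].
  rewrite inE => /eqP mA.
  have mj : m j != 0%N by have : j \in mnm_supp m; [rewrite mA|rewrite inE].
  have le1 : mpoly.lem (mnm1 j) m.
    by apply/mnm_lepP => k; rewrite mnm1E; case: eqP => // <-; rewrite lt0n.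
  have mE := submK le1.
  have ms : (mdeg (mnm_sub m (mnm1 j)) < s.+1)%N.
    have : (mdeg m < s.+2)%N by case: (m).
    by rewrite -[X in (mdeg X < _)%N]mE mdegD mdeg1 addn1 ltnS.
  exists (BMultinom ms); last by apply: val_inj; rewrite /= mE.
  rewrite !inE /= -mA -[X in _ == mnm_supp X]mE -[X in mnm_supp X :\ j]mE.
  rewrite mnm_suppD1.
  case: (boolP (j \in mnm_supp (mnm_sub m (mnm1 j)))) => jm.
    by apply/orP; left; rewrite (setUidPr _) // sub1set.
  by rewrite setU1K // eqxx orbT.
rewrite !inE => /orP[]/eqP mA ->; rewrite /= mnm_suppD1 mA ?setD1K //.
by rewrite (setUidPr _) // sub1set.
Qed.

Lemma nbmonomialsE A s : nbmonomials A s = 'C(s, #|A|).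
Proof.
elim: s A => [|s IH] A; have [->|/set0Pn[j Aj]] := eqVneq A set0;
  rewrite ?nbmonomials0 ?cards0 ?bin0 //.
  rewrite (cardsD1 j) Aj bin0n; apply/eqP; rewrite cards_eq0; apply/eqP/setP => m.
  rewrite !inE; apply/negbTE/eqP => mA.
  have : mnm_supp m == set0.
    by rewrite mnm_supp0 -mdeg_eq0 -leqn0 -ltnS; case: (m).
  by rewrite mA => /eqP e; rewrite e inE in Aj.
by rewrite (nbmonomialsS _ Aj) !IH (cardsD1 j A) Aj add1n binS addnC.
Qed.

Lemma card_monomials (Delta : {set {set 'I_n}}) s :
  #|[set m : bmultinom n s.+1 | mnm_supp m \in Delta]| =
  (\sum_(tau in Delta) 'C(s, #|tau|))%N.
Proof.
rewrite -sum1_card (partition_big (fun m : bmultinom n s.+1 => mnm_supp m)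
  (fun tau => tau \in Delta)) => [|m]; last by rewrite inE.
apply: eq_bigr => tau tD; rewrite -nbmonomialsE /nbmonomials -sum1_card.
apply: eq_bigl => m; rewrite !inE.
by case: eqP => [->|]; rewrite ?tD ?andbF.
Qed.

End CountingMonomials.

Section BinomialPolynomial.

(** The binomial coefficient of X over [d] as a polynomial, of degree [d] and leading coefficient
    1/d!. *)
Definition binp d : {poly rat} :=
  (d`!%:R)^-1 *: \prod_(k < d) ('X - (k%:R)%:P).

Lemma binpE d s : (binp d).[s%:R] = 'C(s, d)%:R.
Proof.
have d0 : (d`!%:R : rat) != 0 by rewrite pnatr_eq0 -lt0n fact_gt0.
rewrite /binp hornerZ; apply: (canLR (mulKf d0)); rewrite -natrM mulnC bin_ffact.
elim: d {d0} => [|d IH]; first by rewrite big_ord0 hornerC ffactn0.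
rewrite big_ord_recr hornerM IH hornerXsubC ffactnSr natrM /=.
(* Truncated subtraction does no harm: for s < d the falling factorial is already 0. *)
have [ds|sd] := leqP d s; first by rewrite natrB.
by rewrite ffact_small // !mul0r.
Qed.

Lemma size_binp d : size (binp d) = d.+1.
Proof.
rewrite size_scale ?invr_eq0 ?pnatr_eq0 -?lt0n ?fact_gt0 //.
by rewrite size_prod_XsubC -[index_enum _]enumT size_enum_ord.
Qed.

Lemma coef_binp d : (binp d)`_d = (d`!%:R)^-1.
Proof.
have /eqP := monic_prod_XsubC (index_enum 'I_d) xpredT (fun k : 'I_d => k%:R : rat).
rewrite /lead_coef size_prod_XsubC -[index_enum _]enumT size_enum_ord /=.
by rewrite enumT coefZ => ->; rewrite mulr1.
Qed.

End BinomialPolynomial.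

(** * Hilbert polynomial and degree of the inverted space *)

Section Degree.
Variables (R : realType) (n : nat) (w : 'rV[R]_n).
Hypotheses (w_gt0 : forall i, 0 < w ord0 i) (w_inj : injective (w ord0)).
Local Notation K := R[i].
Variables (L : {vspace 'rV[K]_n}) (I : {set 'I_n}).

Local Notation Delta := (semi_broken_complex w (circuits L) I).

(** The basis consists of the standard monomials of degree at most [s]: they span by
    [reducible_mpoly] and are independent by [standard_independent]. *)
Lemma hilbert_function_inv s : affine_hilbert_function (inv_space L I) s
  (\sum_(tau in Delta) 'C(s, #|tau|))%N.
Proof.
rewrite -card_monomials; set D := [set m : bmultinom n s.+1 | _].
pose mon (k : 'I_#|D|) : multinom n := bmnm (enum_val k).
have mon_inj : injective mon by move=> k l /val_inj/enum_val_inj.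
have monD k : mnm_supp (mon k) \in Delta by have := enum_valP k; rewrite inE.
have coefE (c : 'I_#|D| -> K) k :
    mcoeff (mon k) (\sum_l c l *: mpolyX K (mon l)) = c k.
  rewrite raddf_sum (bigD1 k) //= mcoeffZ mcoeffX eqxx mulr1 big1 ?addr0 // => l lk.
  by rewrite mcoeffZ mcoeffX (inj_eq mon_inj) (negPf lk) mulr0.
have suppE (c : 'I_#|D| -> K) m :
    m \in msupp (\sum_l c l *: mpolyX K (mon l)) -> exists k, m = mon k.
  move=> /msupp_sum_le /flattenP[t /mapP[k _ ->]] /msuppZ_le.
  by rewrite msuppX mem_seq1 => /eqP; exists k.
exists (fun k => mpolyX K (mon k)); split=> [k|c /vanishes_on_invP cI k|p ps].
- by rewrite mmeasureX /mon; case: (enum_val k).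
- rewrite -(coefE c) (standard_independent w_inj _ cI) ?mcoeff0 // => m.
  by move=> /suppE[l ->].
have [q qs pq] := reducible_mpoly w_gt0 w_inj L I ps.
exists (fun k => mcoeff (mon k) q); apply/vanishes_on_invP.
suff <- : q = \sum_k mcoeff (mon k) q *: mpolyX K (mon k) by [].
apply/mpolyP => m; have [[k ->]|nm] := pselect (exists k, m = mon k).
  by rewrite coefE.
have [/qs[ms mD]|mq] := boolP (m \in msupp q); last first.
  have /eqP -> : mcoeff m q == 0 by rewrite mcoeff_eq0.
  by apply/esym/eqP; rewrite mcoeff_eq0; apply/negP => /suppE.
have mD' : BMultinom (ms : (mdeg m < s.+1)%N) \in D by rewrite inE.
case: nm; exists (enum_rank_in mD' (BMultinom (ms : (mdeg m < s.+1)%N))).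
by rewrite /mon enum_rankK_in.
Qed.

(** With d = [\dim L], no face has more than d elements, so the coefficient of degree d in [P]
    collects 1/d! from each facet and nothing else. *)
Lemma degree_inv_space : has_degree (inv_space L I) (nbfacets w L I).
Proof.
pose P := \sum_(tau in Delta) binp #|tau|; exists P.
  exists 0%N => s _; exists (\sum_(tau in Delta) 'C(s, #|tau|))%N.
    exact: hilbert_function_inv.
  by rewrite /P horner_sum natr_sum; apply: eq_bigr => tau _; apply: binpE.
pose d := \dim L.
have sP : (size P <= d.+1)%N.
  apply: leq_trans (size_sum _ _ _) _; apply/bigmax_leqP => tau tD.
  rewrite size_binp ltnS.
  by case: (complex_pure w_inj tD).
have Pd : P`_d = (nbfacets w L I)%:R / d`!%:R.
  rewrite coef_sum /nbfacets -sum1_card natr_sum mulr_suml.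
  rewrite [LHS]big_mkcond [RHS]big_mkcond; apply: eq_bigr => tau _.
  rewrite [in RHS]in_set; case: (boolP (tau \in Delta)) => //= tD.
  have [->|td] := eqVneq #|tau| d; first by rewrite coef_binp mul1r.
  rewrite nth_default // size_binp ltn_neqAle td /=.
  by case: (complex_pure w_inj tD).
(* Without facets, purity leaves no faces at all, and both [P] and its leading coefficient are 0. *)
have [N0|N0] := posnP (nbfacets w L I).
  have -> : P = 0.
    rewrite /P big1 // => tau tD.
    have [_ [t [_ tD' tc]]] := complex_pure w_inj tD.
    have /eqP : nbfacets w L I = 0%N := N0.
    rewrite cards_eq0 => /eqP/setP/(_ t); rewrite in_set in_set0 tD' tc.
    by rewrite eqxx.
  by rewrite lead_coef0 mulr0 N0.
have Pd0 : P`_d != 0.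
  by rewrite Pd mulf_neq0 ?invr_eq0 ?pnatr_eq0 -?lt0n ?fact_gt0.
have sizeP : size P = d.+1.
  by apply/eqP; rewrite eqn_leq sP ltnNge; apply: contra Pd0 => /(nth_default 0)->.
by rewrite lead_coefE sizeP /= Pd mulrC divfK // pnatr_eq0 -lt0n fact_gt0.
Qed.

End Degree.

Unset Implicit Arguments.
Local Open Scope classical_set_scope.

Theorem theorem1p2 (R : realType) (n : nat) (L : {vspace 'rV[R[i]]_n})
    (I : {set 'I_n}) (w : 'rV[R]_n)
    (hL : conj_invariant L)
    (w_gt0 : forall i, 0 < w ord0 i)
    (w_inj : injective (w ord0)) :
  let N := #|facets (semi_broken_complex w (circuits L) I)| in
  has_degree (inv_space L I) N /\
  generically (fun u : 'rV[R]_n =>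
    ([set C | regions (affine_perp L u) I C /\
              recession_cone C `&` coord_subspace I = [set 0]] #= `I_N)%card).
Proof.
rewrite /= facetsE // -/(nbfacets w L I); split; first exact: degree_inv_space.
have [p p0 hp] := off_hyperplanes_generically (nbcells_generic w_inj I hL).
by exists p => // u /hp <-; apply: regions_card.
Qed.
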